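(* There is an absolute constant $c>0$ such that for all integers $k\ge 1$, all $n\le m$ and every $X\in[n]^m$, $\mathsf{OPT}(X)\le c\,\log k\cdot \mathsf{F}^{k}(X)$.
   Context: $\log(x)$ denotes $\log_2(\max\{2,x\})$. Dynamic BST model: a BST on keys $[n]$ is maintained; to serve access $x_t$ a single pointer starts at the root and the algorithm performs pointer moves (to parent or child) and rotations, the pointer visiting the node holding $x_t$; cost of an access is the number of elementary operations plus one; $\mathsf{OPT}(X)$ is the minimum total cost over all offline BST algorithms with arbitrary initial tree. $k$-finger cost: for a static BST $T$ on $[n]$ (not modified), let $d_T(a,b)$ be the number of edges on the path between $a$ and $b$ in $T$. A $k$-finger strategy is an initial vector $\vec\ell\in[n]^k$ (initial finger positions) and a sequence $\vec f\in[k]^m$, finger $f_t$ serving access $x_t$; its cost is $\sum_{t=1}^m\big(1+d_T(x_t,p_t)\big)$, where $p_t$ is the position of finger $f_t$ before time $t$ (i.e. $x_s$ for the last $s<t$ with $f_s=f_t$, or $\ell_{f_t}$ if none). $\mathsf{F}^k_T(X)$ is the minimum cost over all $k$-finger strategies, and $\mathsf{F}^k(X)=\min_T\mathsf{F}^k_T(X)$ over all BSTs $T$ on $[n]$. *)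

(* Defs.v *)
From Stdlib Require Import Reals ClassicalEpsilon.
From mathcomp Require Import all_boot.
Set Implicit Arguments. Unset Strict Implicit. Unset Printing Implicit Defensive.

Inductive tree : Type := Leaf | Node of tree & nat & tree.

Fixpoint inorder (t : tree) : seq nat :=
  match t with Leaf => [::] | Node l k r => inorder l ++ k :: inorder r end.

Definition bst_on (n : nat) (t : tree) : Prop := inorder t = iota 1 n.

Definition root (t : tree) : option nat :=
  match t with Leaf => None | Node _ k _ => Some k end.

Fixpoint subtree (p : nat) (t : tree) : option tree :=
  match t with
  | Leaf => None
  | Node l k r =>
      if k == p then Some t
      else match subtree p l with Some s => Some s | None => subtree p r end
  end.

Fixpoint parent (p : nat) (t : tree) : option nat :=
  match t with
  | Leaf => None
  | Node l k r =>
      if (root l == Some p) || (root r == Some p) then Some k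
      else match parent p l with Some q => Some q | None => parent p r end
  end.

Definition left_child (p : nat) (t : tree) : option nat :=
  match subtree p t with Some (Node l _ _) => root l | _ => None end.
Definition right_child (p : nat) (t : tree) : option nat :=
  match subtree p t with Some (Node _ _ r) => root r | _ => None end.

Definition rot_left_up (l : tree) (k : nat) (r : tree) : tree :=
  match l with Node a x b => Node a x (Node b k r) | Leaf => Node l k r end.
Definition rot_right_up (l : tree) (k : nat) (r : tree) : tree :=
  match r with Node b y c => Node (Node l k b) y c | Leaf => Node l k r end.

Fixpoint rotate_up (p : nat) (t : tree) : tree :=
  match t with
  | Leaf => Leaf
  | Node l k r =>
      if root l == Some p then rot_left_up l k r
      else if root r == Some p then rot_right_up l k r
      else Node (rotate_up p l) k (rotate_up p r)
  end.

Inductive bst_op : Type := GoParent | GoLeft | GoRight | Rotate.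

Definition apply_op (o : bst_op) (t : tree) (p : nat) : option (tree * nat) :=
  match o with
  | GoParent => match parent p t with Some q => Some (t, q) | None => None end
  | GoLeft => match left_child p t with Some q => Some (t, q) | None => None end
  | GoRight => match right_child p t with Some q => Some (t, q) | None => None end
  | Rotate => match parent p t with Some _ => Some (rotate_up p t, p) | None => None end
  end.

Fixpoint run_access (t : tree) (p : nat) (x : nat) (vis : bool) (ops : seq bst_op)
  : option tree :=
  let vis' := vis || (p == x) in
  match ops with
  | [::] => if vis' then Some t else None
  | o :: ops' =>
      match apply_op o t p with
      | Some (t', p') => run_access t' p' x vis' ops'
      | None => None
      end
  end.

Fixpoint exec (t : tree) (X : seq nat) (S : seq (seq bst_op)) : option nat :=
  match X, S with
  | [::], [::] => Some 0
  | x :: X', ops :: S' =>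
      match root t with
      | None => None
      | Some r =>
          match run_access t r x false ops with
          | None => None
          | Some t' =>
              match exec t' X' S' with
              | None => None
              | Some c => Some ((size ops).+1 + c)
              end
          end
      end
  | _, _ => None
  end.

Definition Pb (P : nat -> Prop) : pred nat :=
  fun c => if excluded_middle_informative (P c) then true else false.

Lemma Pb_ex (P : nat -> Prop) : (exists c, P c) -> exists c, Pb P c.
Proof.
  move=> [c Hc]; exists c; rewrite /Pb.
  by case: (excluded_middle_informative (P c)).
Qed.

(* least element of {c | P c}; 0 if the set is empty (never the case below) *)
Definition min_of (P : nat -> Prop) : nat :=
  match excluded_middle_informative (exists c, P c) with
  | left H => ex_minn (Pb_ex H)
  | right _ => 0
  end.

Definition OPT (n : nat) (X : seq nat) : nat :=
  min_of (fun c => exists (t : tree) (S : seq (seq bst_op)),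
                     bst_on n t /\ exec t X S = Some c).

Fixpoint keys (t : tree) : seq nat :=
  match t with Leaf => [::] | Node l k r => k :: keys l ++ keys r end.

Fixpoint rpath (x : nat) (t : tree) : seq nat :=
  match t with
  | Leaf => [::]
  | Node l k r =>
      if k == x then [:: k]
      else if x \in keys l then k :: rpath x l
      else if x \in keys r then k :: rpath x r
      else [::]
  end.

Fixpoint lcp (s1 s2 : seq nat) : nat :=
  match s1, s2 with
  | a :: s1', b :: s2' => if a == b then (lcp s1' s2').+1 else 0
  | _, _ => 0
  end.

Definition dist (T : tree) (a b : nat) : nat :=
  let pa := rpath a T in let pb := rpath b T in
  (size pa - lcp pa pb) + (size pb - lcp pa pb).

(* cost of serving X with finger sequence f, current finger positions pos
   (fingers are indexed 0..k-1) *)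
Fixpoint fcost (T : tree) (pos : seq nat) (X f : seq nat) : nat :=
  match X, f with
  | x :: X', i :: f' =>
      (dist T x (nth 0 pos i)).+1 + fcost T (set_nth 0 pos i x) X' f'
  | _, _ => 0
  end.

Definition finger_strategy (n k : nat) (X : seq nat) (ell f : seq nat) : Prop :=
  size ell = k /\ all (fun p => (1 <= p <= n)%N) ell /\
  size f = size X /\ all (fun i => (i < k)%N) f.

Definition FkT (n k : nat) (T : tree) (X : seq nat) : nat :=
  min_of (fun c => exists ell f, finger_strategy n k X ell f /\ fcost T ell X f = c).

Definition Fk (n k : nat) (X : seq nat) : nat :=
  min_of (fun c => exists T, bst_on n T /\ FkT n k T X = c).

Definition log2R (x : nat) : R := Rdiv (ln (INR (maxn 2 x))) (ln (INR 2)).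

(* Main.v *)
(** Demaine, Harmon, Iacono, Kane and Patrascu: if the rows of a point set (time
    against keys) are arborally satisfied, the treap ordered by next touch time
    executes them at cost linear in the number of points, because an untouched
    subtree never has to be rearranged.  So it suffices to build a satisfied
    point set of size O(log k) * F^k.

    Split the N unit moves of the fingers into phases of k moves.  A phase visits
    O(k) nodes, and inside it each access touches a root path of a fixed balanced
    tree on these nodes.  A row between two phases touches the nodes visited
    around it, their branching nodes in the static tree, the closest ancestors of
    these on either side, and on every path between two such nodes one mark for
    each of its two sides.  A path side behaves like a deque.  When its mark
    is exposed, the whole side is touched and the element that will be visited
    last becomes the new mark; hence between two visits every key takes part in at
    most one rebuilding, and the boundary rows have O(N) points altogether. *)

From Stdlib Require Import Reals Lra.
From mathcomp Require Import all_boot zify.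
Require Import Defs.
Set Implicit Arguments. Unset Strict Implicit. Unset Printing Implicit Defensive.

(** The fingers move little, but the static paths between them may be long. A boundary row cannot
    afford to touch such a path, and if it touched only its ends, two touches on the path at
    different times could span an empty rectangle. Rectangles that leave a phase are harmless:
    consecutive time windows overlap in a whole phase, so every key touched inside it belongs to
    both neighbouring boundary rows and supplies a corner. For two keys of boundary rows, their
    lowest common ancestor in the static tree lies between them in key, and the hard case is that it
    is one of the two. There the mark of the path side, which stays fixed while it is unvisited,
    either fills the rectangle or makes one of the two touches impossible. Choosing as mark the
    element visited last means that no other element of the side can wait longer for its visit,
    which is what pays for rebuilding. Only the greater side of a path is treated; the lesser side
    is the same statement for the reversed order, so the key order is a parameter. *)

(* lia becomes very slow on contexts with many boolean hypotheses. *)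
Ltac nlia :=
  repeat match goal with H : ?T |- _ =>
    lazymatch T with
    | nat => fail
    | is_true (leq _ _) => fail
    | is_true (andb (leq _ _) (leq _ _)) => fail
    | is_true (negb (leq _ _)) => fail
    | is_true (negb (andb (leq _ _) (leq _ _))) => fail
    | is_true (negb (@eq_op _ _ _)) => fail
    | @eq nat _ _ => fail
    | _ => clear H
    end
  end; lia.

(** * Rotations at a pointer *)

Inductive frame : Type := FL of nat & tree | FR of tree & nat.

Fixpoint plug (c : seq frame) (t : tree) : tree :=
  match c with
  | [::] => t
  | FL k r :: c' => plug c' (Node t k r)
  | FR l k :: c' => plug c' (Node l k t)
  end.

Definition zipper := (seq frame * tree)%type.

(** The model finds the pointer by searching for its key. A context with a focused subtree makes the
    operations local, and distinct keys allow [zstep_apply] to translate them back. A rotation keeps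
    the focus on the key that goes up. *)
Inductive zstep : zipper -> zipper -> Prop :=
| Zdown_l c a x b k r : zstep (c, Node (Node a x b) k r) (FL k r :: c, Node a x b)
| Zdown_r c l k a x b : zstep (c, Node l k (Node a x b)) (FR l k :: c, Node a x b)
| Zup_l c a x b k r : zstep (FL k r :: c, Node a x b) (c, Node (Node a x b) k r)
| Zup_r c l k a x b : zstep (FR l k :: c, Node a x b) (c, Node l k (Node a x b))
| Zrot_l c a x b k r : zstep (FL k r :: c, Node a x b) (c, Node a x (Node b k r))
| Zrot_r c l k a x b : zstep (FR l k :: c, Node a x b) (c, Node (Node l k a) x b).

Inductive zreach : nat -> zipper -> zipper -> Prop :=
| Zrefl m z : zreach m z z
| Zcons m z1 z2 z3 : zstep z1 z2 -> zreach m z2 z3 -> zreach m.+1 z1 z3.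

Lemma zreach_trans m m' z1 z2 z3 :
  zreach m z1 z2 -> zreach m' z2 z3 -> zreach (m + m') z1 z3.
Proof.
move=> h; elim: h m' z3 => [p z|p y1 y2 y3 s _ IH] m' z3 h'; last first.
  by rewrite addSn; apply: Zcons s _; apply: IH.
elim: h' p => [q w|q w1 w2 w3 s _ IH] p; first exact: Zrefl.
by rewrite addnS; apply: Zcons s _.
Qed.

Lemma zreach_leq m m' z1 z2 : m <= m' -> zreach m z1 z2 -> zreach m' z1 z2.
Proof. by move=> le h; rewrite -(subnKC le); apply: zreach_trans h (Zrefl _ _). Qed.

(** A rotation is undone by stepping down to the key that sank, rotating it up and stepping back
    down to the first key, so that the pointer returns as well. *)
Lemma zstep_sym z1 z2 : zstep z1 z2 -> zreach 3 z2 z1.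
Proof.
case=> c; intros; try (by apply: Zcons (Zrefl _ _); constructor).
- apply: Zcons (Zdown_r _ _ _ _ _ _) _; apply: Zcons (Zrot_r _ _ _ _ _ _) _.
  by apply: Zcons (Zdown_l _ _ _ _ _ _) (Zrefl _ _).
- apply: Zcons (Zdown_l _ _ _ _ _ _) _; apply: Zcons (Zrot_l _ _ _ _ _ _) _.
  by apply: Zcons (Zdown_r _ _ _ _ _ _) (Zrefl _ _).
Qed.

Lemma zreach_sym m z1 z2 : zreach m z1 z2 -> zreach (3 * m) z2 z1.
Proof.
elim=> [p z|p y1 y2 y3 /zstep_sym s _ IH]; first exact: Zrefl.
by rewrite mulnS addnC; apply: zreach_trans IH s.
Qed.

Lemma root_in t p : root t = Some p -> p \in inorder t.
Proof. by case: t => //= l k r [->]; rewrite mem_cat mem_head orbT. Qed.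

Lemma subtree_notin p t : p \notin inorder t -> subtree p t = None.
Proof.
elim: t => //= l IHl k r IHr; rewrite mem_cat inE !negb_or eq_sym.
by case/and3P=> pl /negPf-> pr; rewrite IHl // IHr.
Qed.

Lemma parent_notin p t : p \notin inorder t -> parent p t = None.
Proof.
elim: t => //= l IHl k r IHr; rewrite mem_cat inE !negb_or.
case/and3P=> pl _ pr; rewrite IHl // IHr //.
case: eqP => [/root_in|_]; first by rewrite (negPf pl).
by case: eqP => [/root_in|//]; rewrite (negPf pr).
Qed.

Lemma rotate_notin p t : p \notin inorder t -> rotate_up p t = t.
Proof.
elim: t => //= l IHl k r IHr; rewrite mem_cat inE !negb_or.
case/and3P=> pl _ pr; rewrite IHl // IHr //.
case: eqP => [/root_in|_]; first by rewrite (negPf pl).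
by case: eqP => [/root_in|//]; rewrite (negPf pr).
Qed.

Lemma uniq_plug c t : uniq (inorder (plug c t)) -> uniq (inorder t).
Proof.
elim: c t => //= -[k r|l k] c IH t /IH /=; rewrite cat_uniq /=.
  by case/and3P.
by case/and4P.
Qed.

Lemma parent_plug c t p : uniq (inorder (plug c t)) -> p \in inorder t ->
  root t != Some p -> parent p (plug c t) = parent p t.
Proof.
elim: c t => //= -[k r|l k] c IH t u pt nr.
  have := uniq_plug u; rewrite /= cat_uniq /= negb_or => /and3P[_ /andP[kt /hasPn rt] _].
  have pr : p \notin inorder r by apply/negP => /rt/=; rewrite pt.
  have nrr : root r != Some p by apply: contra pr => /eqP/root_in.
  rewrite IH //=; first by rewrite (negPf nr) (negPf nrr) /= (parent_notin pr); case: parent.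
  - by rewrite mem_cat pt.
  - by apply: contra kt => /eqP[->].
have := uniq_plug u; rewrite /= cat_uniq /= negb_or => /and3P[_ /andP[kl /hasPn rt] /andP[kt _]].
have pl := rt _ pt.
have nrl : root l != Some p by apply: contra pl => /eqP/root_in.
rewrite IH //=; first by rewrite (negPf nr) (negPf nrl) /= (parent_notin pl).
- by rewrite mem_cat inE pt !orbT.
- by apply: contra kt => /eqP[->].
Qed.

Lemma rotate_plug c t p : uniq (inorder (plug c t)) -> p \in inorder t ->
  root t != Some p -> rotate_up p (plug c t) = plug c (rotate_up p t).
Proof.
elim: c t => //= -[k r|l k] c IH t u pt nr.
  have := uniq_plug u; rewrite /= cat_uniq /= negb_or => /and3P[_ /andP[kt /hasPn rt] _].
  have pr : p \notin inorder r by apply/negP => /rt/=; rewrite pt.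
  have nrr : root r != Some p by apply: contra pr => /eqP/root_in.
  rewrite IH //=; first by rewrite (negPf nr) (negPf nrr) /= (rotate_notin pr).
  - by rewrite mem_cat pt.
  - by apply: contra kt => /eqP[->].
have := uniq_plug u; rewrite /= cat_uniq /= negb_or => /and3P[_ /andP[kl /hasPn rt] /andP[kt _]].
have pl := rt _ pt.
have nrl : root l != Some p by apply: contra pl => /eqP/root_in.
rewrite IH //=; first by rewrite (negPf nr) (negPf nrl) /= (rotate_notin pl).
- by rewrite mem_cat inE pt !orbT.
- by apply: contra kt => /eqP[->].
Qed.

Lemma subtree_plug c t p : uniq (inorder (plug c t)) -> p \in inorder t ->
  subtree p (plug c t) = subtree p t.
Proof.
elim: c t => //= -[k r|l k] c IH t u pt.
  have := uniq_plug u; rewrite /= cat_uniq /= negb_or => /and3P[_ /andP[kt /hasPn rt] _].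
  have pr : p \notin inorder r by apply/negP => /rt/=; rewrite pt.
  have nk : k == p = false by apply: contraNF kt => /eqP->.
  by rewrite IH //= ?nk ?(subtree_notin pr) ?mem_cat ?pt //; case: subtree.
have := uniq_plug u; rewrite /= cat_uniq /= negb_or => /and3P[_ /andP[kl /hasPn rt] /andP[kt _]].
have nk : k == p = false by apply: contraNF kt => /eqP->.
by rewrite IH //= ?nk ?(subtree_notin (rt _ pt)) ?mem_cat ?inE ?pt ?orbT.
Qed.

Lemma inorder_plug c t t' : inorder t = inorder t' ->
  inorder (plug c t) = inorder (plug c t').
Proof. by elim: c t t' => //= -[k r|l k] c IH t t' e; apply: IH; rewrite /= e. Qed.

Lemma zstep_apply z1 z2 : zstep z1 z2 -> uniq (inorder (plug z1.1 z1.2)) ->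
  inorder (plug z1.1 z1.2) = inorder (plug z2.1 z2.2) /\
  exists o p q, [/\ root z1.2 = Some p, root z2.2 = Some q &
    apply_op o (plug z1.1 z1.2) p = Some (plug z2.1 z2.2, q)].
Proof.
case=> [c a x b k r|c l k a x b|c a x b k r|c l k a x b|c a x b k r|c l k a x b] /= u;
  (split; first by apply: inorder_plug; rewrite /= -?catA).
- exists GoLeft, k, x; split=> //=; rewrite /left_child subtree_plug //= ?eqxx //.
  by rewrite mem_cat mem_head orbT.
- exists GoRight, k, x; split=> //=; rewrite /right_child subtree_plug //= ?eqxx //.
  by rewrite mem_cat mem_head orbT.
- exists GoParent, x, k; split=> //=; rewrite parent_plug //= ?eqxx //.
    by rewrite !mem_cat mem_head orbT.
  by have := uniq_plug u; rewrite /= cat_uniq /= negb_or mem_cat inE => /and3P[_ /andP[+ _] _];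
     apply: contra => /eqP[->]; rewrite eqxx orbT.
- exists GoParent, x, k; split=> //=; rewrite parent_plug //= ?eqxx ?orbT //.
    by rewrite mem_cat inE mem_cat mem_head !orbT.
  by have := uniq_plug u; rewrite /= cat_uniq /= mem_cat inE => /and4P[_ _ + _];
     apply: contra => /eqP[->]; rewrite eqxx orbT.
- have nk : Some k != Some x.
    by have := uniq_plug u; rewrite /= cat_uniq /= negb_or mem_cat inE => /and3P[_ /andP[+ _] _];
     apply: contra => /eqP[->]; rewrite eqxx orbT.
  exists Rotate, x, x; split=> //=; rewrite parent_plug //= ?eqxx //; last first.
    by rewrite !mem_cat mem_head orbT.
  by rewrite rotate_plug //= ?eqxx // !mem_cat mem_head orbT.
- have nk : Some k != Some x.
    by have := uniq_plug u; rewrite /= cat_uniq /= mem_cat inE => /and4P[_ _ + _];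
     apply: contra => /eqP[->]; rewrite eqxx orbT.
  have nl : (root l == Some x) = false.
    have := uniq_plug u; rewrite /= cat_uniq => /and3P[_ /hasPn/(_ x) h _].
    by apply: contraNF (h _) => [/eqP/root_in //|]; rewrite inE mem_cat mem_head !orbT.
  exists Rotate, x, x; split=> //=; rewrite parent_plug //= ?eqxx ?orbT //; last first.
    by rewrite mem_cat inE mem_cat mem_head !orbT.
  by rewrite rotate_plug //= ?eqxx ?nl // mem_cat inE mem_cat mem_head !orbT.
Qed.

Lemma zreach_run m z1 z2 p : zreach m z1 z2 -> uniq (inorder (plug z1.1 z1.2)) ->
  root z1.2 = Some p -> exists q ops, [/\ root z2.2 = Some q, size ops <= m &
    forall x vis ops', exists vis',
      run_access (plug z1.1 z1.2) p x vis (ops ++ ops') =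
      run_access (plug z2.1 z2.2) q x vis' ops'].
Proof.
move=> h; elim: h p => [k z|k y1 y2 y3 s _ IH] p u rp.
  by exists p, [::]; split=> // x vis ops'; exists vis.
have [e [o [p' [q' [r1 r2 ap]]]]] := zstep_apply s u.
move: r1; rewrite rp => -[pp]; subst p'.
have [q [ops [rq sz run]]] := IH q' (etrans (congr1 uniq (esym e)) u) r2.
exists q, (o :: ops); split=> // x vis ops' /=; rewrite ap; exact: run.
Qed.

Lemma zreach_root m z1 z2 q : zreach m z1 z2 -> root z2.2 = Some q ->
  exists p, root z1.2 = Some p.
Proof.
by case=> [_ z|_ y1 y2 y3 s _]; [exists q | case: s => *; eexists; reflexivity].
Qed.

Lemma run_visit m t c l x r : zreach m ([::], t) (c, Node l x r) -> uniq (inorder t) ->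
  exists p ops, [/\ root t = Some p, size ops <= m &
    run_access t p x false ops = Some (plug c (Node l x r))].
Proof.
move=> h u; have [p rp] := zreach_root (q := x) h erefl.
have [q [ops [/= [<-] sz run]]] := zreach_run h u rp.
exists p, ops; split=> //; have [vis] := run x false [::].
by rewrite cats0 /= eqxx orbT.
Qed.

Lemma run_access_mono v t p x b ops t' :
  run_access t p x b ops = Some t' -> run_access t p x (b || v) ops = Some t'.
Proof.
elim: ops t p b => [|o ops IH] t p b /=; first by case: b v => [] [] /=; case: (p == x).
by case: (apply_op o t p) => [[t1 p1]|] // /IH; rewrite orbAC.
Qed.

(** Operations exist only inside accesses. A rearrangement at a row without access is therefore
    prepended to the next access, and dropped if no access follows. *)
Lemma exec_prepend m t t' X S c : zreach m ([::], t) ([::], t') -> uniq (inorder t) ->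
  exec t' X S = Some c -> exists S' c', exec t X S' = Some c' /\ c' <= c + m.
Proof.
move=> h u; case: X S => [|x X] [|ops S] //=.
  by move=> [<-]; exists [::], 0.
case rt : (root t') => [q|] //.
have [p rp] := zreach_root (q := q) h rt.
have [q' [ops0 [/= rq sz run]]] := zreach_run h u rp.
move: rq; rewrite rt => -[eq]; subst q'.
case ra : (run_access t' q x false ops) => [t''|] //.
case ee : (exec t'' X S) => [c0|] // [<-].
have [vis e] := run x false ops.
exists ((ops0 ++ ops) :: S), ((size (ops0 ++ ops)).+1 + c0).
rewrite rp e (run_access_mono (b := false) vis ra) ee size_cat; split=> //; nlia.
Qed.

(** * Exchanging the top part of a tree *)

Section Vine.
Variable a : pred nat.

Definition rooted (t : tree) := if t is Node _ k _ then a k else false.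

(** In key order, each key of the top part is paired with the subtree hanging just before it; the
    last component hangs after all of them. Rearranging the top part leaves exactly these data
    unchanged. *)
Fixpoint chop (t : tree) : seq (tree * nat) * tree :=
  if t is Node l k r then
    if a k then ((chop l).1 ++ ((chop l).2, k) :: (chop r).1, (chop r).2)
    else ([::], t)
  else ([::], t).

Definition build (s : seq (tree * nat)) (g : tree) : tree :=
  foldr (fun p acc => Node p.1 p.2 acc) g s.

Fixpoint off_spine (t : tree) : nat :=
  if t is Node l k r then if a k then size (chop l).1 + off_spine r else 0 else 0.

Lemma chop_unrooted t : ~~ rooted t -> chop t = ([::], t).
Proof. by case: t => //= l k r /negPf->. Qed.

Lemma rootedE t : rooted t = (0 < size (chop t).1).
Proof. by case: t => //= l k r; case: ifP => //= _; rewrite size_cat addnS. Qed.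

Lemma off_spine_leq t : off_spine t <= size (chop t).1.
Proof.
elim: t => //= l _ k r IH; case: ifP => // _ /=.
by rewrite size_cat /=; nlia.
Qed.

Lemma inorder_cat_build s1 h k s2 g :
  inorder (build (s1 ++ (h, k) :: s2) g) = inorder (build s1 h) ++ k :: inorder (build s2 g).
Proof. by elim: s1 => //= -[x y] s1 IH /=; rewrite IH -catA. Qed.

Lemma inorder_chop t : inorder (build (chop t).1 (chop t).2) = inorder t.
Proof.
elim: t => //= l IHl k r IHr; case: ifP => //= _.
by rewrite inorder_cat_build IHl IHr.
Qed.

(* Every rotation moves one more node of the top part onto its right spine. *)
Lemma zreach_vine t c : rooted t ->
  zreach (4 * size (chop t).1) (c, t) (c, build (chop t).1 (chop t).2).
Proof.
(* The first term pays one step down and one rotation per node off the spine, the second for walking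
   down the spine and back. *)
move=> rt; apply: (@zreach_leq (2 * off_spine t + 2 * size (chop t).1)).
  by have := off_spine_leq t; nlia.
have [m] := ubnP (off_spine t + size (chop t).1).
elim: m t c rt => // m IH [//|l k r] c /= ak.
rewrite ak /= size_cat /=.
have [rl|nrl] := boolP (rooted l).
  case: l rl => [//|x y z] /= ay; rewrite ay /= => le.
  have := IH (Node x y (Node z k r)) c ay.
  rewrite /= ay ak /= !size_cat /= -catA cat_cons => H.
  apply: zreach_leq (Zcons (Zdown_l _ _ _ _ _ _) (Zcons (Zrot_l _ _ _ _ _ _) (H _))).
    by move: le; rewrite !size_cat /=; nlia.
  by move: le; rewrite !size_cat /=; nlia.
rewrite (chop_unrooted nrl) /= => le.
have [rr|nrr] := boolP (rooted r); last by rewrite (chop_unrooted nrr) /=; apply: Zrefl.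
have := IH r (FR l k :: c) rr.
case: r rr le => [//|x y z] /= ay; rewrite ay /= => le H.
have H' := H _; move: H'.
case E : (build _ _) => [|x' y' z'] H'.
  by case: (chop x).1 E => [|[? ?] ?].
apply: zreach_leq (Zcons (Zdown_r _ _ _ _ _ _)
   (zreach_trans (H' _) (Zcons (Zup_r _ _ _ _ _ _) (Zrefl 0 _)))).
  by move: le; rewrite !size_cat /=; nlia.
by move: le; rewrite !size_cat /=; nlia.
Qed.

(** Both trees flatten to the same vine. The second flattening is run backwards at three times its
    cost, hence 4 + 3 * 4 = 16. *)
Lemma zreach_same_chop t t' c : rooted t -> chop t = chop t' ->
  zreach (16 * size (chop t).1) (c, t) (c, t').
Proof.
move=> rt e.
have rt' : rooted t' by rewrite rootedE -e -rootedE.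
have h := zreach_vine c rt.
have h' := zreach_sym (zreach_vine c rt').
rewrite -e in h'; apply: zreach_leq (zreach_trans h h'); nlia.
Qed.

Lemma zreach_find t c x : x \in map snd (chop t).1 -> exists c' l r,
  zreach (size (chop t).1) (c, t) (c', Node l x r) /\ plug c t = plug c' (Node l x r).
Proof.
elim: t c => //= l IHl k r IHr c; case: ifP => //= ak.
rewrite map_cat mem_cat inE size_cat /=.
case/orP => [|/orP[/eqP->|]].
- move=> xl; have [c' [l' [r' [h e]]]] := IHl (FL k r :: c) xl.
  exists c', l', r'; split=> //; case: l {IHl e} xl h => //= u v w; case: ifP => // _ _ h.
  by apply: zreach_leq (Zcons (Zdown_l _ _ _ _ _ _) h); nlia.
- by exists c, l, r; split=> //; apply: Zrefl.
- move=> xr; have [c' [l' [r' [h e]]]] := IHr (FR l k :: c) xr.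
  exists c', l', r'; split=> //; case: r {IHr e} xr h => //= u v w; case: ifP => // _ _ h.
  by apply: zreach_leq (Zcons (Zdown_r _ _ _ _ _ _) h); nlia.
Qed.

(** * Cartesian trees with prescribed hanging subtrees *)

Fixpoint heap (f : nat -> nat) (t : tree) : bool :=
  if t is Node l k r then
    [&& all (fun y => f k <= f y) (inorder l ++ inorder r), heap f l & heap f r]
  else true.

(* [o] is the priority of the key that precedes [s], or 0 if there is none. *)
Fixpoint hung (f : nat -> nat) (o : nat) (s : seq (tree * nat)) (g : tree) : bool :=
  if s is (h, k) :: s' then
    all (fun y => maxn o (f k) <= f y) (inorder h) && hung f (f k) s' g
  else all (fun y => o <= f y) (inorder g).

Lemma hung_cat f o s1 h k s2 g : hung f o (s1 ++ (h, k) :: s2) g ->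
  [/\ hung f o s1 h, all (fun y => f k <= f y) (inorder h) & hung f (f k) s2 g].
Proof.
elim: s1 o => [|[x y] s1 IH] o /= /andP[al].
  move=> h2; split=> //; apply: sub_all al => z; nlia.
by move=> /IH[h1 h2 h3]; rewrite al.
Qed.

Lemma hung_last f o s g m : hung f o s g -> m <= o ->
  all (fun p => m <= f p.2) s -> all (fun y => m <= f y) (inorder g).
Proof.
elim: s o => [|[x y] s IH] o /=.
  by move=> al le _; apply: sub_all al => z; apply: leq_trans.
by move=> /andP[_ h] _ /andP[my al]; apply: IH h my al.
Qed.

Lemma hung_all f o s g m : hung f o s g -> all (fun p => m <= f p.2) s ->
  all (fun y => m <= f y) (inorder g) -> all (fun y => m <= f y) (inorder (build s g)).
Proof.
elim: s o => [|[x y] s IH] o //= /andP[al h] /andP[my ms] mg.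
rewrite all_cat /= my (IH _ h ms mg) !andbT.
by apply: sub_all al => z; nlia.
Qed.

Lemma min_split (f : nat -> nat) (p : tree * nat) s : exists s1 h k s2,
  p :: s = s1 ++ (h, k) :: s2 /\ all (fun q => f k <= f q.2) (p :: s).
Proof.
elim: s p => [|q s IH] p; first by exists [::], p.1, p.2, [::]; case: p => x y /=; rewrite leqnn.
have [s1 [h [k [s2 [es kmin]]]]] := IH q.
have [le|gt] := leqP (f k) (f p.2).
  by exists (p :: s1), h, k, s2; rewrite es /= le -es.
exists [::], p.1, p.2, (q :: s); case: p gt => x y /= gt; rewrite leqnn /=; split=> //.
by apply: sub_all kmin => z /=; nlia.
Qed.

(** The key of least priority on the vine becomes the root, and the two halves are built
    recursively. By [hung] each hanging subtree fits under either of its two neighbours, whichever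
    becomes its parent. *)
Lemma cartesian f s g o : hung f o s g -> all (fun p => [&& a p.2, ~~ rooted p.1 & heap f p.1]) s ->
  ~~ rooted g -> heap f g -> exists t, chop t = (s, g) /\ heap f t.
Proof.
have [m] := ubnP (size s); elim: m s g o => // m IH s g o le hs al ng hg.
case: s le hs al => [|p s] le hs al; first by exists g; rewrite (chop_unrooted ng).
have [s1 [h [k [s2 [es kmin]]]]] := min_split f p s.
rewrite es in le hs al kmin *.
move: al kmin le; rewrite !all_cat /= !size_cat /=.
move=> /and3P[al1 /and3P[ak nh hh] al2] /and3P[m1 _ m2] le.
have [hs1 hsh hs2] := hung_cat hs.
have [|t1 [e1 h1]] := IH s1 h o _ hs1 al1 nh hh; first by nlia.
have [|t2 [e2 h2]] := IH s2 g (f k) _ hs2 al2 ng hg; first by nlia.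
exists (Node t1 k t2); rewrite /= ak e1 e2; split=> //.
rewrite h1 h2 !andbT all_cat -(inorder_chop t1) -(inorder_chop t2) e1 e2 /=.
rewrite (hung_all hs1 m1 hsh) (hung_all hs2 m2) //.
exact: hung_last hs2 (leqnn _) m2.
Qed.

Lemma heap_chop f t : heap f t ->
  all (fun p => [&& a p.2, ~~ rooted p.1 & heap f p.1]) (chop t).1 /\
  (~~ rooted (chop t).2 && heap f (chop t).2).
Proof.
elim: t => //= l IHl k r IHr /and3P[al hl hr]; case: ifP => /= ak; last first.
  by rewrite ak al hl hr.
have [l1 l2] := IHl hl; have [r1 r2] := IHr hr.
by rewrite all_cat /= l1 ak l2 r1 r2.
Qed.
End Vine.

(** * Satisfied point sets *)

Section Satisfied.
Variables (n M : nat) (A : nat -> pred nat) (acc : nat -> option nat).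
Let ks := iota 1 n.

Definition satisfied := forall r r' x y, r < r' < M -> A r x -> A r' y -> x != y ->
  exists z s, [/\ A s z, r <= s <= r', minn x y <= z <= maxn x y,
                  (z, s) != (x, r) & (z, s) != (y, r')].

Hypothesis sat : satisfied.
Hypothesis A_ks : forall r x, A r x -> x \in ks.
Hypothesis acc_A : forall r x, acc r = Some x -> r < M -> A r x.

(** The treap priority. For [r <= M] a key that is not touched again before row [M] gets priority
    [M]. *)
Definition next r x := r + find (fun s => A s x) (iota r (M - r)).

Lemma next_geq r x : r <= next r x. Proof. exact: leq_addr. Qed.

Lemma next_A r x : r <= M -> next r x < M -> A (next r x) x.
Proof.
move=> rM h; rewrite /next; have := @nth_find _ 0 (fun s => A s x) (iota r (M - r)).
rewrite nth_iota; last by rewrite /next in h; nlia.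
by apply; rewrite has_find size_iota; rewrite /next in h; nlia.
Qed.

Lemma next_leq r s x : r <= s < M -> A s x -> next r x <= s.
Proof.
move=> rs As; rewrite /next leqNgt; apply/negP => h.
have := @before_find _ 0 (fun s => A s x) (iota r (M - r)) (s - r).
rewrite nth_iota; last by nlia.
have lt : s - r < find (fun s => A s x) (iota r (M - r)) by nlia.
by rewrite subnKC ?As; [move/(_ lt) | nlia].
Qed.

Lemma next_touched r x : r < M -> A r x = (next r x == r).
Proof.
move=> rM; apply/idP/eqP => [Ar|e]; last by rewrite -e next_A // ?e // ltnW.
by apply/eqP; rewrite eqn_leq next_geq next_leq // leqnn.
Qed.

Lemma nextS r x : r < M -> ~~ A r x -> next r.+1 x = next r x.
Proof.
move=> rM nA; rewrite /next; have -> : M - r = (M - r.+1).+1 by nlia.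
by rewrite /= (negPf nA); nlia.
Qed.

(** Satisfaction enters here. If [y] were touched again before [k], the rectangle from [k] in row
    [r] to that touch would contain a third point. It is neither in row [r] nor on key [k], so it
    spans a smaller rectangle of the same kind, and the descent never ends. *)
Lemma next_neighbour r k y : r < M -> A r k -> y != k ->
  (forall z, minn k y <= z <= maxn k y -> z != k -> ~~ A r z) ->
  next r.+1 k <= next r.+1 y.
Proof.
move=> rM Ak yk gap; rewrite leqNgt; apply/negP => lt.
have yM : next r.+1 y < M.
  by apply: leq_trans lt _; rewrite /next; have := find_size (fun s => A s k) (iota r.+1 (M - r.+1));
    rewrite size_iota; nlia.
have Ay := next_A rM yM; have rs := next_geq r.+1 y.
move: (next r.+1 y) lt yM Ay rs => s.
have [m] := ubnP ((k - y) + (y - k) + s).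
elim: m y s yk gap => // m IH y s yk gap le lt sM Ay rs.
have [||z [s' [Az rs' zk nz nz']]] := @sat r s k y _ Ak Ay; [by nlia|by rewrite eq_sym|].
have [ek|nk] := eqVneq z k.
  rewrite ek in Az nz; have [e|ne] := eqVneq s' r; first by rewrite e eqxx in nz.
  have rM' : r.+1 <= s' < M by nlia.
  have := next_leq rM' Az; nlia.
have [e|ne] := eqVneq s' r; first by subst s'; have := gap z zk nk; rewrite Az.
apply: (IH z s' nk) => //; try by nlia.
  by move=> u hu; apply: gap; nlia.
have [e|ny] := eqVneq z y; last by nlia.
by have : s' != s; [apply: contra nz' => /eqP->; rewrite e|nlia].
Qed.

(** No touched key separates a hanging subtree from its neighbours on the vine, so [next_neighbour]
    applies from both sides. [p] is the position just before the interval of keys under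
    consideration. *)
Lemma hung_next r p o s g L : r < M -> o = 0 \/ (A r p /\ o = next r.+1 p) ->
  all (fun q => A r q.2 && all (predC (A r)) (inorder q.1)) s ->
  all (predC (A r)) (inorder g) ->
  inorder (build s g) = iota p.+1 L -> hung (next r.+1) o s g.
Proof.
move=> rM; elim: s p o L => [|[h k] s IH] p o L /= ho.
  move=> _ ng eg; apply/allP => y yg.
  case: ho => [->//|[Ap ->]]; apply: next_neighbour => //.
    by apply: contraTneq yg => ->; rewrite eg mem_iota; lia.
  move=> z hz zp; apply: (allP ng); move: yg; rewrite eg !mem_iota; lia.
move=> /andP[/andP[Ak nh] al] ng e.
have sL : L = size (inorder h) + (size (inorder (build s g))).+1.
  by rewrite -(size_iota p.+1 L) -e size_cat.
move: e; rewrite sL iotaD => /eqP; rewrite eqseq_cat ?size_iota //.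
move=> /andP[/eqP eh /eqP[ek er]]; rewrite -ek in er.
apply/andP; split; last by apply: IH er => //; right.
apply/allP => y yh; rewrite geq_max; apply/andP; split.
  case: ho => [->//|[Ap ->]]; apply: next_neighbour => //.
    by apply: contraTneq yh => ->; rewrite eh mem_iota; lia.
  move=> z hz zp; apply: (allP nh); move: yh; rewrite eh !mem_iota; lia.
apply: next_neighbour => //.
  by apply: contraTneq yh => ->; rewrite eh mem_iota; lia.
move=> z hz zp; apply: (allP nh); move: yh; rewrite eh !mem_iota; lia.
Qed.

Lemma eq_heap f g t : {in inorder t, f =1 g} -> heap f t = heap g t.
Proof.
elim: t => //= l IHl k r IHr e.
have el : {in inorder l, f =1 g} by move=> x xl; apply: e; rewrite mem_cat xl.
have er : {in inorder r, f =1 g} by move=> x xr; apply: e; rewrite mem_cat inE xr !orbT.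
rewrite (IHl el) (IHr er); congr (_ && _); apply: eq_in_all => x.
by rewrite mem_cat e ?mem_cat ?mem_head ?orbT // => /orP[/el->|/er->].
Qed.

(** Touched keys have the least possible priority [r], so heap order places none of them below an
    untouched key: they form exactly the top part. *)
Lemma chop_untouched r t : r < M -> heap (next r) t ->
  all (fun q => A r q.2 && all (predC (A r)) (inorder q.1)) (chop (A r) t).1 /\
  all (predC (A r)) (inorder (chop (A r) t).2).
Proof.
move=> rM; elim: t => //= l IHl k r' IHr /and3P[al hl hr]; case: ifP => /= Ak.
  have [l1 l2] := IHl hl; have [r1 r2] := IHr hr.
  by rewrite all_cat /= l1 l2 r1 r2 Ak.
have nk : r < next r k by rewrite ltn_neqAle next_geq eq_sym -next_touched // Ak.
have al' : all (predC (A r)) (inorder l ++ inorder r').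
  apply: sub_all al => y le; rewrite /= next_touched // gtn_eqF //.
  exact: leq_trans nk le.
by move: al'; rewrite !all_cat /= Ak.
Qed.

Lemma mem_chop (a : pred nat) t x : all (predC a) (inorder (chop a t).2) ->
  all (fun q => a q.2 && all (predC a) (inorder q.1)) (chop a t).1 ->
  x \in inorder t -> a x -> x \in map snd (chop a t).1.
Proof.
rewrite -(inorder_chop a t); move: (chop a t).1 (chop a t).2 => s g ng.
elim: s => [|[h k] s IH] /=; first by move=> _ xg ax; have := allP ng _ xg; rewrite /= ax.
move=> /andP[/andP[_ nh] al]; rewrite mem_cat inE => /or3P[xh|/eqP->|xs] ax.
- by have := allP nh _ xh; rewrite /= ax.
- by rewrite mem_head.
- by rewrite inE IH ?orbT.
Qed.

Lemma size_chop (a : pred nat) t :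
  all (fun q => a q.2) (chop a t).1 -> size (chop a t).1 <= count a (inorder t).
Proof.
rewrite -(inorder_chop a t); move: (chop a t).1 (chop a t).2 => s g.
by elim: s => //= -[h k] s IH /= /andP[ak al]; rewrite count_cat /= ak; have := IH al; nlia.
Qed.

Lemma next_tree r t : r < M -> inorder t = ks -> heap (next r) t ->
  exists t', [/\ inorder t' = ks, heap (next r.+1) t' & chop (A r) t = chop (A r) t'].
Proof.
move=> rM et ht; have [c1 c2] := chop_untouched rM ht.
have [h1 /andP[h2 h3]] := heap_chop (A r) ht.
have hg : hung (next r.+1) 0 (chop (A r) t).1 (chop (A r) t).2.
  by apply: (@hung_next r 0 0 _ _ n) => //; [left | rewrite inorder_chop].
have eqh g : all (predC (A r)) (inorder g) -> heap (next r) g -> heap (next r.+1) g.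
  move=> ng; rewrite -(@eq_heap (next r.+1)) // => x xg.
  by rewrite nextS //; apply: (allP ng).
have [|t' [e' h']] := cartesian hg _ h2 (eqh _ c2 h3).
  elim: (chop (A r) t).1 h1 c1 => //= -[h k] s IH /= /andP[/and3P[-> -> hh] al].
  by move=> /andP[/andP[_ nh] al']; rewrite (eqh _ nh hh) IH.
exists t'; split=> //; last by rewrite e' -surjective_pairing.
by rewrite -et -(inorder_chop (A r) t') e' inorder_chop.
Qed.

(** Per touched key, 16 operations exchange the top part and 1 pays for walking down to the accessed
    key, which is touched and hence in the top part. *)
Lemma treap_exec d : forall r t, r + d = M -> inorder t = ks -> heap (next r) t ->
  exists S c, exec t (pmap acc (iota r d)) S = Some c /\
    c <= size (pmap acc (iota r d)) + 17 * \sum_(r <= s < M) count (A s) ks.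
Proof.
elim: d => [|d IH] r t rd et ht; first by exists [::], 0.
have rM : r < M by nlia.
have [t' [et' ht' ec]] := next_tree rM et ht.
have rd' : r.+1 + d = M by nlia.
have [S' [c' [ex' le']]] := IH r.+1 t' rd' et' ht'.
have ut : uniq (inorder t) by rewrite et iota_uniq.
have ut' : uniq (inorder t') by rewrite et' iota_uniq.
have [c1 c2] := chop_untouched rM ht.
set m := count (A r) ks in le' *.
have szm : size (chop (A r) t).1 <= m.
  rewrite /m -et; apply: size_chop; by apply: sub_all c1 => q /andP[].
have reach : zreach (16 * m) ([::], t) ([::], t').
  have [rt|nrt] := boolP (rooted (A r) t).
    by apply: zreach_leq (zreach_same_chop _ rt ec); nlia.
  have nrt' : ~~ rooted (A r) t' by move: nrt; rewrite !rootedE ec.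
  by move: ec; rewrite !chop_unrooted // => -[->]; apply: Zrefl.
rewrite big_ltn //= -/m.
case E : (acc r) => [x|] /=; last first.
  have [S [c [ex le]]] := exec_prepend reach ut ex'.
  by exists S, c; split=> //; move: le'; nlia.
have Ax := acc_A E rM.
have xt : x \in inorder t' by rewrite et' (A_ks Ax).
have xc : x \in map snd (chop (A r) t').1 by apply: mem_chop Ax; rewrite -?ec.
have [cc [l [u [h e]]]] := zreach_find [::] xc.
have [p [ops [rp sz run]]] := run_visit (zreach_trans reach h) ut.
rewrite /= in e; exists (ops :: S'), ((size ops).+1 + c').
rewrite rp run -e ex'; split=> //; move: sz le' szm; rewrite ec; nlia.
Qed.

Lemma treap_exists : exists t, inorder t = ks /\ heap (next 0) t.
Proof.
have hg o : hung (next 0) o [seq (Leaf, k) | k <- ks] Leaf.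
  by elim: (ks) o => //= k s IH o; apply: IH.
have al : all (fun p => [&& predT p.2, ~~ rooted predT p.1 & heap (next 0) p.1])
    [seq (Leaf, k) | k <- ks] by elim: (ks).
have [t [e h]] := cartesian (hg 0) al isT isT.
exists t; split=> //; rewrite -(inorder_chop predT t) e /=.
by elim: (ks) => //= k s ->.
Qed.

Theorem satisfied_OPT : OPT n (pmap acc (iota 0 M)) <=
  size (pmap acc (iota 0 M)) + 17 * \sum_(0 <= s < M) count (A s) ks.
Proof.
have [t [et ht]] := treap_exists.
have [S [c [ex le]]] := treap_exec (add0n M) et ht.
apply: leq_trans le; rewrite /OPT /min_of.
case: ClassicalEpsilon.excluded_middle_informative => [H|//].
case: ex_minnP => m _; apply; rewrite /Pb.
by case: ClassicalEpsilon.excluded_middle_informative => // -[]; exists t, S.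
Qed.
End Satisfied.

(** * Hands and marks *)

Lemma leq_size_rel (A B : eqType) (r : A -> B -> Prop) (s : seq A) (t : seq B) :
  uniq s -> (forall x, x \in s -> exists2 y, y \in t & r x y) ->
  (forall x x' y, x \in s -> x' \in s -> r x y -> r x' y -> x = x') ->
  size s <= size t.
Proof.
elim: s t => [|x s IH] t //= /andP[xs us] ex inj.
have [y yt rxy] := ex x (mem_head _ _).
have sub : size (rem y t) = (size t).-1 by rewrite size_rem.
have t0 : 0 < size t by case: t yt {ex sub}.
rewrite -(prednK t0) ltnS -sub; apply: IH => // [z zs|z z' w zs z's].
  have [w wt rzw] := ex z (mem_behead (s:=x::s) zs).
  exists w => //; have nwy : w != y.
    apply/eqP => wy; rewrite wy in rzw.
    have /= e := inj _ _ _ (mem_head x s) (mem_behead (s:=x::s) zs) rxy rzw.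
    by rewrite e zs in xs.
  move: wt; rewrite (perm_mem (perm_to_rem yt)) inE (negPf nwy) //.
by apply: inj; rewrite inE ?zs ?z's orbT.
Qed.

Lemma exists_minimal (r : rel nat) (s : seq nat) x :
  (forall x, r x x = false) -> (forall y x z, r x y -> r y z -> r x z) ->
  x \in s -> exists2 m, m \in s & forall z, z \in s -> ~~ r z m.
Proof.
move=> irr tr; elim: s x => // a s IH x _.
case: s IH => [|b s] IH.
  by exists a; rewrite ?mem_head // => z; rewrite inE => /eqP->; rewrite irr.
have [m ms mmin] := IH b (mem_head _ _).
have [am|nam] := boolP (r a m).
  exists a; rewrite ?mem_head // => z; rewrite inE => /orP[/eqP->|/mmin zm].
    by rewrite irr.
  by apply: contra zm => za; apply: tr am.
exists m; first by rewrite inE ms orbT.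
by move=> z; rewrite inE => /orP[/eqP->|/mmin].
Qed.

Lemma count_le_rel (I J : eqType) (r : I -> J -> Prop) (s : seq I) (t : seq J)
    (P : pred I) (Q : pred J) :
  uniq s -> (forall x, x \in s -> P x -> exists y, [/\ y \in t, Q y & r x y]) ->
  (forall x x' y, P x -> P x' -> r x y -> r x' y -> x = x') ->
  count P s <= count Q t.
Proof.
move=> us ex inj; rewrite -!size_filter.
apply: (@leq_size_rel _ _ r); first exact: filter_uniq.
  move=> x; rewrite mem_filter => /andP[Px xs].
  by have [y [yt Qy rxy]] := ex x xs Px; exists y => //; rewrite mem_filter Qy.
by move=> x x' y; rewrite !mem_filter => /andP[Px _] /andP[Px' _]; apply: inj.
Qed.

(** Each [r] time is charged to the latest [v] time not after it, or to [None]. Two [r] times cannot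
    share a charge, because a [v] time separates them. *)
Lemma count_separated (r v : pred nat) N :
  (forall i j, i < j < N -> r i -> r j -> exists2 l, i < l <= j & v l) ->
  count r (iota 0 N) <= (count v (iota 0 N)).+1.
Proof.
move=> sep.
pose R l (o : option nat) := if o is Some m then m <= l < N /\ forall p, m < p <= l -> ~~ v p
  else forall p, p <= l -> ~~ v p.
pose Q (o : option nat) := if o is Some m then v m else true.
apply: (@leq_trans (count Q (None :: map Some (iota 0 N)))); last first.
  by rewrite /= count_map.
apply: (@count_le_rel _ _ (fun l o => l < N /\ R l o)); first exact: iota_uniq.
  move=> l; rewrite mem_iota /= add0n => lN _.
  have [/hasP[p pl vp]|no] := boolP (has v (iota 0 l.+1)).
    have ex : exists m, (m <= l) && v m by exists p; move: pl; rewrite mem_iota vp; lia.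
    have ub m : (m <= l) && v m -> m <= l by case/andP.
    case: (ex_maxnP ex ub) => m /andP[ml vm] mmax.
    exists (Some m); split=> //.
      by rewrite inE map_f ?orbT // mem_iota; lia.
    split=> //; split; first by lia.
    move=> q /andP[mq ql]; apply/negP => vq.
    by have := mmax q; rewrite ql vq => /(_ isT); lia.
  exists None; split; rewrite ?mem_head //; split=> // p pl.
  by apply: contra no => vp; apply/hasP; exists p; rewrite ?mem_iota; lia.
have half l l' o : r l -> r l' -> l' < N -> R l o -> R l' o -> l < l' -> False.
  move=> rl rl' lN Rl Rl' ll.
  have [m lm vm] : exists2 m, l < m <= l' & v m by apply: sep; rewrite ?ll.
  case: o Rl Rl' => [q [h1 h2] [h3 h4]|h1 h2].
    by have := h4 m; rewrite vm => /(_ _)/negP; case=> //; lia.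
  by have := h2 m; rewrite vm => /(_ _)/negP; case=> //; lia.
move=> l l' o rl rl' [lN Rl] [lN' Rl'].
case: (ltngtP l l') => // h; first by case: (half l l' o).
by case: (half l' l o).
Qed.

(* [V l] is the set of keys visited in the l-th time window.  The order [lt] is
   [<] or [>], so that each argument also yields its mirror image.  The last two
   fields say that a finger changes sides of a node only by visiting that node. *)
Record hand (n : nat) (anc lt : rel nat) (V : nat -> pred nat) : Prop := Hand {
  hand_irr : forall x, lt x x = false;
  hand_tr : forall y x z, lt x y -> lt y z -> lt x z;
  hand_tot : forall x y, x != y -> lt x y || lt y x;
  hand_keys : forall z v, anc z v -> (z \in iota 1 n) && (v \in iota 1 n);
  hand_anc_refl : forall z, z \in iota 1 n -> anc z z;
  hand_anc_tr : forall b a c, anc a b -> anc b c -> anc a c;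
  hand_anc_anti : forall a b, anc a b -> anc b a -> a = b;
  hand_conv1 : forall z v c, anc z v -> lt v c -> lt c z -> anc z c;
  hand_conv2 : forall z v c, anc z v -> lt z c -> lt c v -> anc z c;
  hand_lca : forall x y, x \in iota 1 n -> y \in iota 1 n -> lt x y ->
    exists w, [/\ ~~ lt w x, ~~ lt y w, anc w x & anc w y];
  hand_V : forall l v, V l v -> v \in iota 1 n;
  hand_back : forall i j v, i <= j -> V j v -> exists2 v', V i v' &
    forall z, (forall l, i <= l <= j -> ~~ V l z) ->
      anc z v && lt v z = anc z v' && lt v' z /\ anc z v && lt z v = anc z v' && lt z v';
  hand_fwd : forall i j v, i <= j -> V i v -> exists2 v', V j v' &
    forall z, (forall l, i <= l <= j -> ~~ V l z) ->
      anc z v && lt v z = anc z v' && lt v' z /\ anc z v && lt z v = anc z v' && lt z v'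
}.

Lemma hand_mirror n anc lt V : hand n anc lt V -> hand n anc (fun a b => lt b a) V.
Proof.
case=> irr tr tot ks refl atr anti c1 c2 lca Vks back fwd; split=> //.
- by move=> y x z xy yz; apply: tr yz xy.
- by move=> x y xy; rewrite orbC tot.
- by move=> z v c a vc cz; apply: c2 a cz vc.
- by move=> z v c a zc cv; apply: c1 a cv zc.
- by move=> x y xk yk xy; have [w [? ? ? ?]] := lca y x yk xk xy; exists w.
- by move=> i j v ij Vv; have [v' V' h] := back i j v ij Vv; exists v' => // z /h[].
- by move=> i j v ij Vv; have [v' V' h] := fwd i j v ij Vv; exists v' => // z /h[].
Qed.

(** * Path sides for one orientation of the key order *)

Section Core.
Variables (n : nat) (anc lt : rel nat) (V : nat -> pred nat) (M : nat).
Hypothesis handV : hand n anc lt V.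
Let ks := iota 1 n.
Let lt_irr := hand_irr handV.
Let lt_tr := hand_tr handV.
Let lt_tot := hand_tot handV.
Let anc_ks := hand_keys handV.
Let anc_refl := hand_anc_refl handV.
Let anc_tr := hand_anc_tr handV.
Let anc_anti := hand_anc_anti handV.
Let conv1 := hand_conv1 handV.
Let conv2 := hand_conv2 handV.
Let lca := hand_lca handV.
Let V_ks := hand_V handV.

Definition inL z v := anc z v && lt v z.
Definition inR z v := anc z v && lt z v.
Let track_back : forall i j v, i <= j -> V j v -> exists2 v', V i v' &
    forall z, (forall l, i <= l <= j -> ~~ V l z) ->
      inL z v = inL z v' /\ inR z v = inR z v' := hand_back handV.
Let track_fwd : forall i j v, i <= j -> V i v -> exists2 v', V j v' &
    forall z, (forall l, i <= l <= j -> ~~ V l z) ->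
      inL z v = inL z v' /\ inR z v = inR z v' := hand_fwd handV.

Definition exV l (P : pred nat) := has (fun v => V l v && P v) ks.
Lemma exVP l (P : pred nat) : reflect (exists2 v, V l v & P v) (exV l P).
Proof.
apply: (iffP hasP) => [[v _ /andP[]]|[v Vv Pv]]; first by exists v.
by exists v; [apply: V_ks Vv | rewrite Vv].
Qed.

Definition branch l z := exV l (inL z) && exV l (inR z).
Definition special l z := V l z || branch l z.
(* The nodes on the lt-greater side of the paths between special nodes. *)
Definition chain l z := [&& ~~ V l z, exV l (inL z) & ~~ exV l (inR z)].
(* Two such nodes are on the same path when the same visited keys are below them. *)
Definition same l x y :=
  [&& chain l x, chain l y & all (fun v => V l v ==> (inL x v == inL y v)) ks].

Lemma inL_ks z v : inL z v -> (z \in ks) && (v \in ks).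
Proof. by case/andP => /anc_ks. Qed.

Lemma chain_ks l z : chain l z -> z \in ks.
Proof. by case/and3P => _ /exVP[v _ /inL_ks/andP[]]. Qed.

Lemma sameP l x y :
  reflect [/\ chain l x, chain l y & forall v, V l v -> inL x v = inL y v] (same l x y).
Proof.
apply: (iffP and3P) => -[hx hy h]; split=> //.
  by move=> v Vv; move/allP: h => /(_ v (V_ks Vv)); rewrite Vv => /eqP.
by apply/allP => v _; apply/implyP => /h ->.
Qed.

Lemma same_sym l x y : same l x y -> same l y x.
Proof. by case/sameP => hx hy h; apply/sameP; split=> // v /h. Qed.
Lemma same_tr l x y z : same l x y -> same l y z -> same l x z.
Proof.
by move=> /sameP[hx hy h] /sameP[_ hz h']; apply/sameP; split=> // v Vv; rewrite h // h'.
Qed.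
Lemma same_refl l x : chain l x -> same l x x.
Proof. by move=> h; apply/sameP. Qed.

Lemma inL_nest x y v : inL x v -> inL y v -> lt x y -> inL y x.
Proof.
move=> /andP[xv vx] /andP[yv vy] xy; rewrite /inL xy andbT.
exact: conv1 yv vx xy.
Qed.

Lemma inL_tr x y v : inL y x -> anc x v -> inL y v.
Proof.
move=> /andP[yx xy] xv; rewrite /inL (anc_tr yx xv) /=.
have absurd : ~~ anc x y.
  by apply/negP => xy'; rewrite (anc_anti yx xy') lt_irr in xy.
have [vy|vy] := eqVneq v y; first by rewrite -vy xv in absurd.
case/orP: (lt_tot vy) => // yv.
by rewrite (conv2 xv xy yv) in absurd.
Qed.

Lemma inR_tr x y v : inR y x -> anc x v -> inR y v.
Proof.
move=> /andP[yx xy] xv; rewrite /inR (anc_tr yx xv) /=.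
have absurd : ~~ anc x y.
  by apply/negP => xy'; rewrite (anc_anti yx xy') lt_irr in xy.
have [vy|vy] := eqVneq v y; first by rewrite -vy xv in absurd.
case/orP: (lt_tot vy) => // yv.
by rewrite (conv1 xv yv xy) in absurd.
Qed.

Lemma lt_asym x y : lt x y -> ~~ lt y x.
Proof. by move=> xy; apply/negP => /(lt_tr xy); rewrite lt_irr. Qed.

Lemma le_lt_tr y x z : ~~ lt y x -> lt y z -> lt x z.
Proof.
have [->//|xy] := eqVneq x y.
by case/orP: (lt_tot xy) => [xy' _ /(lt_tr xy')|->].
Qed.

Lemma lt_le_tr y x z : lt x y -> ~~ lt z y -> lt x z.
Proof.
have [->//|zy] := eqVneq z y.
by case/orP: (lt_tot zy) => [->|yz xy _] //; apply: lt_tr yz.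
Qed.

Definition untouched i j z := forall l, i <= l <= j -> ~~ V l z.

(** As long as [z] is unvisited no finger changes its position relative to [z], so the fingers carry
    from row to row which sides of [z] have visited keys below. *)
Lemma chain_fwd i j z : i <= j -> untouched i j z -> chain i z -> chain j z.
Proof.
move=> ij nz /and3P[_ /exVP[v Vv Lv] nR]; apply/and3P; split.
- by apply: nz; rewrite ij leqnn.
- have [v' Vv' /(_ z nz)[e _]] := track_fwd ij Vv.
  by apply/exVP; exists v'; rewrite -?e.
- apply: contra nR => /exVP[u Vu Ru].
  have [v' Vv' /(_ z nz)[_ e]] := track_back ij Vu.
  by apply/exVP; exists v'; rewrite -?e.
Qed.

Lemma chain_back i j z : i <= j -> untouched i j z -> chain j z -> chain i z.
Proof.
move=> ij nz /and3P[_ /exVP[v Vv Lv] nR]; apply/and3P; split.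
- by apply: nz; rewrite ij leqnn.
- have [v' Vv' /(_ z nz)[e _]] := track_back ij Vv.
  by apply/exVP; exists v'; rewrite -?e.
- apply: contra nR => /exVP[u Vu Ru].
  have [v' Vv' /(_ z nz)[_ e]] := track_fwd ij Vu.
  by apply/exVP; exists v'; rewrite -?e.
Qed.

Lemma same_fwd i j x y : i <= j -> untouched i j x -> untouched i j y ->
  same i x y -> same j x y.
Proof.
move=> ij nx ny /sameP[cx cy e]; apply/sameP; split.
- exact: chain_fwd nx cx.
- exact: chain_fwd ny cy.
- move=> v Vv; have [v' Vv' h] := track_back ij Vv.
  by rewrite (h x nx).1 (h y ny).1 e.
Qed.

Lemma same_back i j x y : i <= j -> untouched i j x -> untouched i j y ->
  same j x y -> same i x y.
Proof.
move=> ij nx ny /sameP[cx cy e]; apply/sameP; split.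
- exact: chain_back nx cx.
- exact: chain_back ny cy.
- move=> v Vv; have [v' Vv' h] := track_fwd ij Vv.
  by rewrite (h x nx).1 (h y ny).1 e.
Qed.

(** Among the greater ancestors of [w], the closest in key is also the deepest, so [x] is the last
    one on the way down to [w]. *)
Definition nearest w x :=
  [&& anc x w, lt w x & all (fun z => anc z w && lt w z ==> ~~ lt z x) ks].
Definition edge l x := has (fun w => special l w && nearest w x) ks.

(** The path below [y] ends at [w], the lowest common ancestor of the least and the greatest visited
    key below [y]. It is visited, or it has visited keys on both sides and branches. *)
Lemma chain_special l y : chain l y -> exists w,
  [/\ special l w, inL y w & forall v, V l v -> inL y v -> anc w v].
Proof.
move=> /and3P[_ /exVP[v0 Vv0 Lv0] _].
pose P := [seq v <- ks | V l v && inL y v].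
have PE v : (v \in P) = V l v && inL y v.
  rewrite mem_filter; have [/andP[Vv _] /=|//] := boolP (V l v && inL y v).
  exact: V_ks Vv.
have v0P : v0 \in P by rewrite PE Vv0.
have [v1 v1P m1] := exists_minimal lt_irr lt_tr v0P.
have tr' (b a c : nat) : lt b a -> lt c b -> lt c a by move=> ba cb; apply: lt_tr ba.
have [v2 v2P m2] := exists_minimal (r := fun a b => lt b a) lt_irr tr' v0P.
move: (v1P) (v2P); rewrite !PE => /andP[V1 L1] /andP[V2 L2].
have [w [sw w1 w2 a1 a2]] : exists w,
    [/\ special l w, ~~ lt w v1, ~~ lt v2 w, anc w v1 & anc w v2].
  have [e|ne] := eqVneq v1 v2.
    exists v1; rewrite /special V1 -e lt_irr; split=> //; exact: anc_refl (V_ks V1).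
  have v12 : lt v1 v2 by case/orP: (lt_tot ne) => // h; have := m1 _ v2P; rewrite h.
  have [w [w1 w2 a1 a2]] := lca (V_ks V1) (V_ks V2) v12.
  exists w; split=> //; rewrite /special.
  have [//|nVw] := boolP (V l w); rewrite /=.
  have n1 : v1 != w by apply: contra nVw => /eqP<-.
  have n2 : w != v2 by apply: contra nVw => /eqP->.
  apply/andP; split; apply/exVP.
    by exists v1; rewrite // /inL a1 /=; case/orP: (lt_tot n1) => // h; rewrite h in w1.
  by exists v2; rewrite // /inR a2 /=; case/orP: (lt_tot n2) => // h; rewrite h in w2.
have Pw v : V l v -> inL y v -> anc w v.
  move=> Vv Lv; have vP : v \in P by rewrite PE Vv.
  have [->|nw] := eqVneq v w; first by have /andP[] := anc_ks a1; move/anc_refl.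
  case/orP: (lt_tot nw) => h.
    have [->//|n1] := eqVneq v v1.
    apply: conv1 a1 _ h; case/orP: (lt_tot n1) => // h'.
    by have := m1 _ vP; rewrite h'.
  have [->//|n2] := eqVneq v v2.
  apply: conv2 a2 h _; case/orP: (lt_tot n2) => // h'.
  by have := m2 _ vP; rewrite h'.
exists w; split=> //.
case/andP: (L1) => y1 lty1; case/andP: (L2) => y2 lty2.
have wy : lt w y by apply: le_lt_tr w2 lty2.
rewrite /inL wy andbT; have [->//|n1] := eqVneq w v1.
apply: conv1 y1 _ wy; case/orP: (lt_tot n1) => // h; by rewrite h in w1.
Qed.

Lemma chain_bottom l y : chain l y -> exists b,
  [/\ edge l b, ~~ lt y b & forall v, V l v -> inL y v -> inL b v].
Proof.
move=> cy; have [w [sw Lw Pw]] := chain_special cy.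
case/andP: (Lw) => yw wy.
pose s := [seq z <- ks | anc z w && lt w z].
have ys : y \in s by rewrite mem_filter yw wy (chain_ks cy).
have [b bs bmin] := exists_minimal lt_irr lt_tr ys.
move: (bs); rewrite mem_filter => /andP[/andP[bw wb] bk].
exists b; split; last 2 first.
- exact: bmin.
- move=> v Vv /(Pw _ Vv) wv; apply: inL_tr wv; by rewrite /inL bw.
- have /andP[_ wk] := anc_ks yw.
  apply/hasP; exists w => //; rewrite sw /nearest bw wb /=.
  apply/allP => z zk; apply/implyP => h; apply: bmin.
  by rewrite mem_filter h.
Qed.

(** A node of the same side has the same visited keys below it, so it is a greater ancestor of the
    special node [w] too, and [x] is the closest of these. *)
Lemma edge_bottom l x z : edge l x -> same l z x -> ~~ lt z x.
Proof.
case/hasP => w wk /andP[sw /and3P[xw wx /allP near]] /sameP[cz cx e].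
apply/negP => zx; suff /andP[zw wz] : inL z w.
  have := near z (chain_ks cz); by rewrite zw wz zx.
case/orP: sw => [Vw|/andP[/exVP[v1 V1 L1] /exVP[v2 V2 R2]]].
  by rewrite e // /inL xw.
have Lw : inL x w by rewrite /inL xw.
case/andP: L1 => a1 l1; case/andP: R2 => a2 l2.
have := inL_tr Lw a1; rewrite -e // => /andP[z1 _].
have := inL_tr Lw a2; rewrite -e // => /andP[_ z2].
have wz := lt_tr l2 z2.
by rewrite /inL wz andbT; apply: conv1 z1 l1 wz.
Qed.

(** * Marks and rebuildings of path sides *)

(* The delay until the next visit, minus 1, or M if there is none within M rows. *)
Definition nxt l x := find (fun d => V (l + d) x) (iota 1 M).
Definition best l q :=
  all (fun x => same l q x ==>
         (nxt l x < nxt l q) || (nxt l x == nxt l q) && (q <= x)) ks.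

(* A mark is kept as long as it stays on its path; a path without a kept mark is
   rebuilt and gets its [best] element as new mark. *)
Fixpoint old_mark l : pred nat :=
  match l with
  | 0 => pred0
  | l'.+1 => fun q => chain l' q &&
      (old_mark l' q ||
       ~~ has (fun p => old_mark l' p && same l' p q) ks && best l' q)
  end.
Definition rebuilt l x := chain l x && ~~ has (fun p => old_mark l p && same l p x) ks.
Definition mark l q := chain l q && (old_mark l q || rebuilt l q && best l q).

Lemma old_markS l q : old_mark l.+1 q = mark l q.
Proof. by rewrite /mark /rebuilt /=; case: (chain l q). Qed.

Lemma mark_chain l q : mark l q -> chain l q.
Proof. by case/andP. Qed.

Lemma mark_keep i j q : i <= j -> untouched i j q -> mark i q -> mark j q.
Proof.
elim: j => [|j IH]; first by rewrite leqn0 => /eqP->.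
rewrite leq_eqVlt => /orP[/eqP->//|]; rewrite ltnS => ij nq mq.
have cq : chain j.+1 q.
  by apply: chain_fwd (mark_chain mq) => //; apply: leq_trans ij _.
rewrite /mark cq old_markS IH // => l /andP[il lj].
by apply: nq; rewrite il (leq_trans lj).
Qed.

Lemma mark_birth j q : mark j q -> exists i,
  [/\ i <= j, rebuilt i q, best i q & forall l, i <= l <= j -> mark l q].
Proof.
elim: j => [|j IH] mq.
  case/andP: (mq) => cq /=/andP[rq bq]; exists 0; split=> // l.
  by rewrite leqn0 => /eqP->.
case/andP: (mq) => cq /orP[|/andP[rq bq]]; last first.
  exists j.+1; split=> // l /andP[h h']; have -> : l = j.+1 by nlia.
  by [].
rewrite old_markS => /IH[i [ij rq bq h]]; exists i; split=> //; first by nlia.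
move=> l /andP[il]; rewrite leq_eqVlt => /orP[/eqP->//|lj].
by apply: h; rewrite il.
Qed.

Lemma mark_untouched i j q : (forall l, i <= l <= j -> mark l q) -> untouched i j q.
Proof. by move=> h l /h/mark_chain/and3P[]. Qed.

Lemma rebuilt_same l x y : rebuilt l x -> same l x y -> rebuilt l y.
Proof.
move=> /andP[cx nx] sxy; case/sameP: (sxy) => _ cy _; rewrite /rebuilt cy /=.
apply: contra nx => /hasP[p pk /andP[op spy]]; apply/hasP; exists p => //.
by rewrite op (same_tr spy (same_sym sxy)).
Qed.

Lemma chain2_untouched l q : chain l q -> chain l.+1 q -> untouched l l.+1 q.
Proof.
move=> /and3P[h _ _] /and3P[h' _ _] i /andP[li il].
have [->//|->//] : i = l \/ i = l.+1 by nlia.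
Qed.

(** Two inherited marks that share a side now shared it one row earlier, since neither was visited.
    New marks arise only on sides without an inherited one, and there [best] breaks ties by key. *)
Lemma mark_uniq l q q' : mark l q -> mark l q' -> same l q q' -> q = q'.
Proof.
elim: l q q' => [|l IH] q q' mq mq' s; case/andP: (mq) => cq; case/andP: (mq') => cq'.
  move=> /=/andP[r' b'] /andP[r b].
  move/allP: b => /(_ q' (chain_ks cq')); rewrite s /=.
  move/allP: b' => /(_ q (chain_ks cq)); rewrite (same_sym s) /=; nlia.
case/orP => [o'|/andP[r' b']] /orP[o|/andP[r b]].
- move: o o'; rewrite !old_markS => o o'; apply: IH => //.
  apply: same_back s => //; apply: chain2_untouched => //; exact: mark_chain.
- case/andP: r => _ /hasP[]; exists q'; first exact: chain_ks cq'.
  by rewrite o' same_sym.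
- case/andP: r' => _ /hasP[]; exists q; first exact: chain_ks cq.
  by rewrite o.
- move/allP: b => /(_ q' (chain_ks cq')); rewrite s /=.
  move/allP: b' => /(_ q (chain_ks cq)); rewrite (same_sym s) /=; nlia.
Qed.

Lemma chain_marked l x : chain l x -> ~~ rebuilt l x ->
  exists2 q, mark l q & same l x q.
Proof.
rewrite /rebuilt => -> /=; rewrite negbK => /hasP[q qk /andP[oq s]].
exists q; last exact: same_sym.
by rewrite /mark oq; case/sameP: s => ->.
Qed.

(** Had [q] become a mark at row [i] or later, its whole side, and [x] with it, would have been
    rebuilt at that row. *)
Lemma mark_past i j x q : i <= j -> untouched i j x ->
  (forall l, i <= l <= j -> ~~ rebuilt l x) -> mark j q -> same j x q ->
  forall l, i <= l <= j -> mark l q /\ same l x q.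
Proof.
move=> ij nx nr mq s; have [b [bj rb _ mb]] := mark_birth mq.
have nq := mark_untouched mb.
have bi : b < i.
  rewrite ltnNge; apply/negP => ib; have /negP[] : ~~ rebuilt b x by apply: nr; nlia.
  apply: rebuilt_same rb _; apply: same_sym; apply: same_back s => //.
  by move=> l hl; apply: nx; nlia.
move=> l hl; split; first by apply: mb; nlia.
apply: same_back s; first by nlia.
  by move=> m hm; apply: nx; nlia.
by move=> m hm; apply: nq; nlia.
Qed.

(** Sides are convex along static paths: [y] is an ancestor of [x] and a descendant of [q], so the
    visited keys below it are squeezed between theirs. *)
Lemma same_between l x y q : same l x q -> inL y x -> lt y q -> same l x y.
Proof.
case/sameP => cx cq e Lyx yq.
case/and3P: (cx) => nVx /exVP[v0 V0 L0] nRx.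
have y0 : inL y v0 by case/andP: L0 => a _; apply: inL_tr a.
have Lqy : inL q y by apply: inL_nest y0 _ yq; rewrite -e.
have f v : V l v -> inL y v -> inL x v.
  by move=> Vv /andP[a _]; rewrite e //; apply: inL_tr a.
have g v : inL x v -> inL y v by case/andP => a _; apply: inL_tr a.
case/andP: (Lyx) => _ xy.
apply/sameP; split=> //; last by move=> v Vv; apply/idP/idP => [/g|/(f _ Vv)].
apply/and3P; split.
- apply/negP => Vy; have := Lqy; rewrite -e // => /andP[_ yx].
  by move/negP: (lt_asym xy).
- by apply/exVP; exists v0.
- apply/negP => /exVP[v Vv /andP[a yv]].
  have := inL_tr Lqy a; rewrite -e // => /andP[_ vx].
  by have := lt_tr (lt_tr yv vx) xy; rewrite lt_irr.
Qed.

(** [b] stands for the lower end of the side of [y], as given by [chain_bottom]. Since [x] is not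
    less than [b] and has a visited key below it, [x] lies on that side as well. *)
Lemma same_above l x y b v0 : inL y x -> V l v0 -> anc x v0 -> chain l y ->
  ~~ lt x b -> (forall v, V l v -> inL y v -> inL b v) -> same l x y.
Proof.
move=> Lyx V0 x0 cy bx hb; case/andP: (Lyx) => _ xy.
have b0 : inL b v0 by apply: hb => //; apply: inL_tr x0.
have x0' : inL x v0.
  by case/andP: b0 => _ v0b; rewrite /inL x0 (lt_le_tr v0b bx).
have f v : V l v -> inL y v -> inL x v.
  move=> Vv /(hb _ Vv) bv; have [<-//|nbx] := eqVneq b x.
  case/orP: (lt_tot nbx) => h; last by rewrite h in bx.
  by case/andP: bv => bv _; apply: inL_tr bv; apply: inL_nest b0 x0' h.
have g v : inL x v -> inL y v by case/andP => a _; apply: inL_tr a.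
apply/sameP; split=> //; last by move=> v Vv; apply/idP/idP => [/g|/(f _ Vv)].
apply/and3P; split.
- by apply/negP => /f/(_ Lyx)/andP[_]; rewrite lt_irr.
- by apply/exVP; exists v0.
- apply/negP => /exVP[v Vv /andP[a xv]].
  by have /andP[_ /(lt_tr xv)] := f _ Vv (inL_tr Lyx a); rewrite lt_irr.
Qed.


(** A branching node is charged to its predecessor among the visited keys. Two branching nodes with
    the same predecessor have no visited key between them; by convexity each is then an ancestor of
    the other. *)
Lemma count_branch l : count (branch l) ks <= count (V l) ks.
Proof.
apply: (@count_le_rel _ _ (fun z v => [/\ V l v, lt v z &
  forall u, V l u -> lt u z -> ~~ lt v u])); first exact: iota_uniq.
  move=> z zk /andP[/exVP[v0 V0 /andP[_ L0]] _].
  pose s := [seq v <- ks | V l v && lt v z].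
  have vs : v0 \in s by rewrite mem_filter V0 L0 (V_ks V0).
  have tr' (b a c : nat) : lt b a -> lt c b -> lt c a by move=> ba cb; apply: lt_tr ba.
  have [v] := exists_minimal (r := fun a b => lt b a) lt_irr tr' vs.
  rewrite mem_filter => /andP[/andP[Vv vz] vk] vmax.
  exists v; split=> //; split=> // u Vu uz; apply: vmax.
  by rewrite mem_filter Vu uz (V_ks Vu).
suff half z z' v : branch l z -> branch l z' -> lt z z' -> V l v -> lt v z ->
    (forall u, V l u -> lt u z' -> ~~ lt v u) -> False.
  move=> z z' v bz bz' [Vv vz h] [_ vz' h'].
  have [//|/lt_tot/orP[zz|zz]] := eqVneq z z'.
    by case: (half z z' v).
  by case: (half z' z v).
move=> /andP[_ /exVP[v1 V1 /andP[a1 l1]]] /andP[/exVP[v2 V2 /andP[a2 l2]] _] zz Vv vz h.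
have z1 : ~~ lt v1 z'.
  apply: contraTN isT => h1; have := h v1 V1 h1; by rewrite (lt_tr vz l1).
have z2 : lt v2 z by apply: le_lt_tr (h _ V2 l2) vz.
have az : anc z' z by apply: conv1 a2 z2 zz.
have az' : anc z z'.
  have [e|ne] := eqVneq z' v1; first by rewrite e.
  case/orP: (lt_tot ne) => h1; last by rewrite h1 in z1.
  exact: conv2 a1 zz h1.
by rewrite (anc_anti az az') lt_irr in zz.
Qed.

Lemma count_special l : count (special l) ks <= 2 * count (V l) ks.
Proof.
have := count_branch l; have := count_predUI (V l) (branch l) ks.
by rewrite (eq_count (a2 := special l)) //; nlia.
Qed.

Lemma count_edge l : count (edge l) ks <= 2 * count (V l) ks.
Proof.
apply: leq_trans (count_special l).
apply: (@count_le_rel _ _ (fun x w => nearest w x && (x \in ks))); first exact: iota_uniq.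
  by move=> x xk /hasP[w wk /andP[sw nw]]; exists w; rewrite nw xk.
move=> x x' w _ _ /andP[/and3P[a1 l1 h1] xk] /andP[/and3P[a2 l2 h2] xk'].
have := allP h1 _ xk'; have := allP h2 _ xk; rewrite a1 a2 l1 l2 /= => u u'.
have [//|/lt_tot] := eqVneq x x'.
by rewrite (negPf u) (negPf u').
Qed.

(** The node [w] of [chain_special] determines the side, and each side has one mark. *)
Lemma count_mark l : count (mark l) ks <= 2 * count (V l) ks.
Proof.
apply: leq_trans (count_special l).
apply: (@count_le_rel _ _ (fun q w => inL q w /\ forall v, V l v -> inL q v -> anc w v));
  first exact: iota_uniq.
  move=> q qk /mark_chain/chain_special[w [sw Lw h]]; exists w; split=> //.
  by case/andP: (inL_ks Lw).
move=> q q' w mq mq' [Lq hq] [Lq' hq']; apply: (mark_uniq mq mq').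
apply/sameP; split; try exact: mark_chain.
move=> v Vv; apply/idP/idP => [/(hq _ Vv)|/(hq' _ Vv)]; exact: inL_tr.
Qed.

Lemma rebuilt_marked l x : rebuilt l x -> exists2 q, mark l q &
  same l x q /\ (nxt l x <= nxt l q).
Proof.
move=> rx; case/andP: (rx) => cx _.
pose r a b := (nxt l b < nxt l a) || (nxt l a == nxt l b) && (a < b).
have irr a : r a a = false by rewrite /r; nlia.
have tr b a c : r a b -> r b c -> r a c by rewrite /r; nlia.
have xs : x \in [seq y <- ks | same l x y].
  by rewrite mem_filter same_refl ?(chain_ks cx).
have [q] := exists_minimal irr tr xs.
rewrite mem_filter => /andP[sq qk] qmin; exists q; last first.
  by split=> //; have := qmin _ xs; rewrite /r; nlia.
rewrite /mark (rebuilt_same rx sq).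
case/sameP: (sq) => _ -> _; apply/orP; right; apply/allP => y yk.
apply/implyP => sy; have := qmin y.
by rewrite mem_filter yk (same_tr sq sy) /r => /(_ isT); nlia.
Qed.

(** If [x] is not visited after row [i] up to row [j], neither is the mark chosen for its side at
    row [i], whose next visit is no earlier. It then remains a mark on the side of [x], and row [j]
    does not rebuild. The bound [j < M] keeps row [j] within the horizon of [nxt]. *)
Lemma rebuilt_separated i j x : i < j < M -> rebuilt i x -> rebuilt j x ->
  exists2 l, i < l <= j & V l x.
Proof.
move=> /andP[ij jM] ri rj.
have [/hasP[l hl Vl]|no] := boolP (has (fun l => V l x) (iota i.+1 (j - i))).
  by exists l => //; move: hl; rewrite mem_iota; nlia.
have nV l : i < l <= j -> ~~ V l x.
  by move=> hl; apply: contra no => Vl; apply/hasP; exists l; rewrite // mem_iota; nlia.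
have nVx : untouched i j x.
  move=> l hl; have [->|nl] := eqVneq l i; first by case/andP: ri => /and3P[].
  by apply: nV; nlia.
have [q mq [sq nq]] := rebuilt_marked ri.
have far y : ~~ has (fun d => V (i + d) y) (iota 1 (j - i)) = (j - i <= nxt i y).
  rewrite /nxt; have -> : M = (j - i) + (M - (j - i)) by nlia.
  rewrite iotaD find_cat size_iota; case: ifP => [/=|_ /=]; last by nlia.
  by rewrite has_find size_iota; nlia.
have nVq : untouched i j q.
  move=> l hl; have [->|nl] := eqVneq l i; first by case/and3P: (mark_chain mq).
  have : j - i <= nxt i q.
    apply: leq_trans nq; rewrite -far; apply/hasPn => d; rewrite mem_iota => hd.
    by apply: nV; nlia.
  rewrite -far => /hasPn/(_ (l - i)); rewrite mem_iota subnKC; last by nlia.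
  by apply; nlia.
case/andP: rj => _ /hasP[]; exists q; first exact: chain_ks (mark_chain mq).
rewrite (@same_fwd i j) //; [|exact: ltnW|exact: same_sym].
rewrite andbT -[j](@prednK j); last by nlia.
rewrite old_markS; apply: (mark_keep _ _ mq); first by nlia.
by move=> l hl; apply: nVq; nlia.
Qed.

(** Counted per key, rebuildings exceed visits by at most one, because a visit lies between any two
    of them; this is the term [n]. *)
Lemma sum_rebuilt : \sum_(0 <= l < M) count (rebuilt l) ks <=
  n + \sum_(0 <= l < M) count (V l) ks.
Proof.
have E (P : nat -> pred nat) :
    \sum_(0 <= l < M) count (P l) ks = \sum_(x <- ks) count (P^~ x) (iota 0 M).
  under eq_bigr do rewrite -sum1_count big_mkcond.
  rewrite exchange_big /=; apply: eq_bigr => x _.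
  by rewrite -sum1_count [RHS]big_mkcond /index_iota subn0.
rewrite !E; apply: (@leq_trans (\sum_(x <- ks) (1 + count (V^~ x) (iota 0 M)))).
  apply: leq_sum => x _; apply: count_separated => i j ij; exact: rebuilt_separated.
by rewrite big_split /= sum1_size size_iota.
Qed.

(** * No empty rectangle between two boundary rows *)

Section Satisfied.
Variable A : nat -> pred nat.
Hypothesis A_special : forall l x, special l x -> A l x.
Hypothesis A_edge : forall l x, edge l x -> A l x.
Hypothesis A_mark : forall l x, mark l x -> A l x.
Hypothesis A_rebuilt : forall l x, rebuilt l x -> A l x.
Hypothesis A_chain : forall l x, A l x -> chain l x -> [|| edge l x, mark l x | rebuilt l x].
Hypothesis A_V : forall l x, A l x -> exists2 v, V l v & anc x v.

Lemma A_of_V l x : V l x -> A l x.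
Proof. by move=> h; apply: A_special; rewrite /special h. Qed.

Lemma A_nchain l x v : ~~ A l x -> V l v -> inL x v -> chain l x.
Proof.
move=> nA Vv Lv; apply/and3P; split.
- by apply: contra nA; apply: A_of_V.
- by apply/exVP; exists v.
- apply: contra nA => hR; apply: A_special; rewrite /special /branch hR andbT.
  by apply/orP; right; apply/exVP; exists v.
Qed.

(** If [w] is never touched in between, a visited key below [y] can be traced back to row [i] and
    stays on the greater side of [w]; so [w] branches at row [i]. *)
Lemma satisfied_lca i j x y w : i <= j -> A i x -> A j y -> inL w x -> inR w y ->
  exists2 l, i <= l <= j & A l w.
Proof.
move=> ij /A_V[v0 V0 a0] /A_V[v1 V1 a1] Lx Ry.
have [/hasP[l hl Al]|no] := boolP (has (fun l => A l w) (iota i (j - i).+1)).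
  by exists l => //; rewrite mem_iota in hl; nlia.
have nA l : i <= l <= j -> ~~ A l w.
  move=> hl; apply: contra no => Al; apply/hasP; exists l => //.
  by rewrite mem_iota; nlia.
have nV : untouched i j w by move=> l /nA; apply: contra; apply: A_of_V.
have [v' V' /(_ w nV)[_ e]] := track_back ij V1.
exists i; first by rewrite leqnn.
apply: A_special; rewrite /special /branch; apply/orP; right.
apply/andP; split; apply/exVP; first by exists v0 => //; apply: inL_tr a0.
by exists v' => //; rewrite -e; apply: inR_tr a1.
Qed.

(** In an empty rectangle [x] and [y] share a side at row [i], and the mark [q] of the side of [x]
    stays the same up to row [j]. If [q] is less than [x], nothing explains the touch of [x]; if [q]
    lies between [x] and [y], it fills the rectangle; if it lies beyond [y], then [y] is on the side
    of [x] at row [j] too, and nothing explains the touch of [y]. *)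
Lemma satisfied_up i j x y : i < j -> A i x -> A j y -> inL y x ->
  ~ (forall z s, A s z -> i <= s <= j -> ~~ lt z x -> ~~ lt y z ->
       (z = x /\ s = i) \/ (z = y /\ s = j)).
Proof.
move=> ij Ax Ay Lyx empty; case/andP: (Lyx) => ayx xy.
have nxy : x <> y by move=> e; rewrite e lt_irr in xy.
have nAy l : i <= l < j -> ~~ A l y.
  move=> hl; apply/negP => Al.
  case: (empty y l Al); rewrite ?lt_irr ?lt_asym //; [nlia|case; congruence|nlia].
have nAx l : i < l <= j -> ~~ A l x.
  move=> hl; apply/negP => Al.
  case: (empty x l Al); rewrite ?lt_irr ?lt_asym //; [nlia|nlia|case; congruence].
have [v0 V0 x0] := A_V Ax.
have cy : chain i y by apply: A_nchain (nAy i _) V0 (inL_tr Lyx x0); nlia.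
have [b [eb yb hb]] := chain_bottom cy.
(* The lower end [b] of the side is touched at row [i]; if it exceeded [x], it would be a third
   point. *)
have bx : ~~ lt x b.
  apply/negP => xb; case: (empty b i (A_edge eb)) => //; first by nlia.
  - exact: lt_asym.
  - by case=> e; rewrite e lt_irr in xb.
  - by nlia.
have sxy := same_above Lyx V0 x0 cy bx hb.
case/sameP: (sxy) => cx _ _.
have nVx : untouched i j x.
  move=> l hl; have [->|nl] := eqVneq l i; first by case/and3P: cx.
  by apply: (contra (@A_of_V l _)); apply: nAx; nlia.
have nr l : i <= l <= j -> ~~ rebuilt l x.
  move=> hl; have [->|nl] := eqVneq l i.
    by apply/negP => /rebuilt_same/(_ sxy)/A_rebuilt; apply/negP; apply: nAy; nlia.
  by apply: (contra (@A_rebuilt l _)); apply: nAx; nlia.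
have ij' := ltnW ij.
have cxj : chain j x by apply: chain_fwd cx.
have [q mq sq] : exists2 q, mark j q & same j x q.
  by apply: chain_marked => //; apply: nr; nlia.
have hq := mark_past ij' nVx nr mq sq.
have [miq siq] : mark i q /\ same i x q by apply: hq; nlia.
have nqx : q != x.
  by apply/eqP => e; move: (A_mark mq); rewrite e; apply/negP; apply: nAx; nlia.
case/orP: (lt_tot nqx) => [qx|xq].
  case/or3P: (A_chain Ax cx) => [ex|mx|rx].
  - by have := edge_bottom ex (same_sym siq); rewrite qx.
  - have /negP[] : ~~ A j x by apply: nAx; nlia.
    by apply: A_mark; apply: mark_keep mx.
  - by have /negP[] : ~~ rebuilt i x by apply: nr; nlia.
have yq : lt y q.
  have [e|] := eqVneq q y; first have /negP[] : ~~ A i y by apply: nAy; nlia.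
    by rewrite -e; apply: A_mark.
  case/lt_tot/orP => // qy; case: (empty q i (A_mark miq)).
  - by nlia.
  - exact: lt_asym.
  - exact: lt_asym.
  - by case=> e; rewrite e lt_irr in xq.
  - by nlia.
have sj := same_between sq Lyx yq.
case/sameP: (sj) => _ cyj _.
have nrj : ~~ rebuilt j y.
  by apply/negP => /rebuilt_same/(_ (same_sym sj)); apply/negP; apply: nr; nlia.
case/or3P: (A_chain Ay cyj) => [ey|my|ry].
- by have := edge_bottom ey sj; rewrite xy.
- have [b' [bj rb _ mb]] := mark_birth my.
  have [e|nb] := eqVneq b' j; first by rewrite -e rb in nrj.
  have /negP[] : ~~ A j.-1 y by apply: nAy; nlia.
  by apply: A_mark; apply: mb; nlia.
- by rewrite ry in nrj.
Qed.

(** The analysis of [satisfied_up] with the rows exchanged: [x] and [y] share a side at row [j], and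
    unless its mark fills the rectangle, its position leaves the touch of [y] at row [j] or that of
    [x] at row [i] unexplained. *)
Lemma satisfied_down i j x y : i < j -> A i x -> A j y -> inL x y ->
  ~ (forall z s, A s z -> i <= s <= j -> ~~ lt z y -> ~~ lt x z ->
       (z = x /\ s = i) \/ (z = y /\ s = j)).
Proof.
move=> ij Ax Ay Lxy empty; case/andP: (Lxy) => axy yx.
have nxy : x <> y by move=> e; rewrite e lt_irr in yx.
have nAy l : i <= l < j -> ~~ A l y.
  move=> hl; apply/negP => Al.
  case: (empty y l Al); rewrite ?lt_irr ?lt_asym //; [nlia|case; congruence|nlia].
have nAx l : i < l <= j -> ~~ A l x.
  move=> hl; apply/negP => Al.
  case: (empty x l Al); rewrite ?lt_irr ?lt_asym //; [nlia|nlia|case; congruence].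
have [v0 V0 y0] := A_V Ay.
have cx : chain j x by apply: A_nchain (nAx j _) V0 (inL_tr Lxy y0); nlia.
have [b [eb xb hb]] := chain_bottom cx.
have yb : ~~ lt y b.
  apply/negP => yb; case: (empty b j (A_edge eb)) => //; first by nlia.
  - exact: lt_asym.
  - by nlia.
  - by case=> e; rewrite e lt_irr in yb.
have syx := same_above Lxy V0 y0 cx yb hb.
case/sameP: (syx) => cy _ _.
have nVy : untouched i j y.
  move=> l hl; have [->|nl] := eqVneq l j; first by case/and3P: cy.
  by apply: (contra (@A_of_V l _)); apply: nAy; nlia.
have nr l : i <= l <= j -> ~~ rebuilt l y.
  move=> hl; have [->|nl] := eqVneq l j.
    by apply/negP => /rebuilt_same/(_ syx)/A_rebuilt; apply/negP; apply: nAx; nlia.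
  by apply: (contra (@A_rebuilt l _)); apply: nAy; nlia.
have ij' := ltnW ij.
have [q mq sq] : exists2 q, mark j q & same j y q.
  by apply: chain_marked => //; apply: nr; nlia.
have hq := mark_past ij' nVy nr mq sq.
have [miq siq] : mark i q /\ same i y q by apply: hq; nlia.
have nqy : q != y.
  by apply/eqP => e; move: (A_mark miq); rewrite e; apply/negP; apply: nAy; nlia.
have nmy : ~~ mark j y.
  apply/negP => my; have [b' [bj rb _ mb]] := mark_birth my.
  have [e|nb] := eqVneq b' j; first have /negP[] : ~~ rebuilt j y by apply: nr; nlia.
    by rewrite -{1}e.
  have /negP[] : ~~ A j.-1 y by apply: nAy; nlia.
  by apply: A_mark; apply: mb; nlia.
case/orP: (lt_tot nqy) => [qy|yq].
  case/or3P: (A_chain Ay cy) => [ey|my|ry].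
  - by have := edge_bottom ey (same_sym sq); rewrite qy.
  - by rewrite my in nmy.
  - by have /negP[] : ~~ rebuilt j y by apply: nr; nlia.
have xq : lt x q.
  have [e|] := eqVneq q x; first have /negP[] : ~~ A j x by apply: nAx; nlia.
    by rewrite -e; apply: A_mark.
  case/lt_tot/orP => // qx; case: (empty q j (A_mark mq)).
  - by nlia.
  - exact: lt_asym.
  - exact: lt_asym.
  - by nlia.
  - by case=> e; rewrite e lt_irr in yq.
have si := same_between siq Lxy xq.
case/sameP: (si) => _ cxi _.
case/or3P: (A_chain Ax cxi) => [ex|mx|rx].
- by have := edge_bottom ex si; rewrite yx.
- have /negP[] : ~~ A j x by apply: nAx; nlia.
  apply: A_mark; apply: mark_keep mx => // l hl.
  have [->|nl] := eqVneq l i; first by case/and3P: cxi.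
  by apply: (contra (@A_of_V l _)); apply: nAx; nlia.
- have /negP[] : ~~ rebuilt i y by apply: nr; nlia.
  exact: rebuilt_same rx (same_sym si).
Qed.
End Satisfied.
End Core.

(** * Both orientations together *)

Section Touched.
Variables (n : nat) (anc lt : rel nat) (V : nat -> pred nat) (M : nat).

Definition touched l x :=
  let gt := fun a b => lt b a in
  [|| special n anc lt V l x, edge n anc lt V l x, edge n anc gt V l x,
      mark n anc lt V M l x, mark n anc gt V M l x,
      rebuilt n anc lt V M l x | rebuilt n anc gt V M l x].
End Touched.

Lemma special_mirror n anc lt V l x :
  special n anc (fun a b => lt b a) V l x = special n anc lt V l x.
Proof. by rewrite /special /branch andbC. Qed.

Lemma touched_mirror n anc lt V M l x :
  touched n anc (fun a b => lt b a) V M l x = touched n anc lt V M l x.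
Proof.
rewrite /touched special_mirror /=.
move: (edge n anc lt V l x) (edge n anc (fun a b => lt b a) V l x)
  (mark n anc lt V M l x) (mark n anc (fun a b => lt b a) V M l x)
  (rebuilt n anc lt V M l x) (rebuilt n anc (fun a b => lt b a) V M l x).
by case: (special _ _ _ _ _ _) => //= -[] [] [] [] [] [].
Qed.

Section TouchedSatisfied.
Variables (n : nat) (anc lt : rel nat) (V : nat -> pred nat) (M : nat).
Hypothesis handV : hand n anc lt V.
Let ks := iota 1 n.
Let gt := fun a b => lt b a.
Let A := touched n anc lt V M.

Lemma special_V l w : special n anc lt V l w -> exists2 v, V l v & anc w v.
Proof.
case/orP => [Vw|/andP[/(exVP handV)[v Vv /andP[a _]] _]]; last by exists v.
by exists w => //; apply: hand_anc_refl handV _ (hand_V handV Vw).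
Qed.

Lemma touched_V l x : A l x -> exists2 v, V l v & anc x v.
Proof.
have hand' := hand_mirror handV.
have chV lt' : hand n anc lt' V -> chain n anc lt' V l x -> exists2 v, V l v & anc x v.
  by move=> h /and3P[_ /(exVP h)[v Vv /andP[a _]] _]; exists v.
have edV lt' : special n anc lt' V l =1 special n anc lt V l -> edge n anc lt' V l x ->
    exists2 v, V l v & anc x v.
  move=> e /hasP[w _ /andP[]]; rewrite e => /special_V[v Vv wv] /andP[xw _].
  by exists v => //; apply: hand_anc_tr handV _ _ _ xw wv.
rewrite /A /touched => /orP[|/orP[|/orP[|/orP[|/orP[|/orP[|]]]]]].
- exact: special_V.
- exact: edV.
- by apply: edV => w; apply: special_mirror.
- by move/mark_chain; apply: chV.
- by move/mark_chain; apply: chV.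
- by case/andP => c _; apply: chV c.
- by case/andP => c _; apply: chV c.
Qed.

Lemma touched_chain l x : A l x -> chain n anc lt V l x ->
  [|| edge n anc lt V l x, mark n anc lt V M l x | rebuilt n anc lt V M l x].
Proof.
move=> Ax cx; have hand' := hand_mirror handV.
case/and3P: (cx) => nV hL nR.
have ngt : ~~ chain n anc gt V l x by apply: contra nR => /and3P[].
move: Ax; rewrite /A /touched => /orP[|/orP[|/orP[|/orP[|/orP[|/orP[|]]]]]].
- by rewrite /special /branch (negPf nV) (negPf nR) andbF.
- by move=> ->.
- case/hasP => w _ /andP[]; rewrite special_mirror => /special_V[v Vv wv] /and3P[xw xlw _].
  case/negP: nR; apply/(exVP handV); exists v => //.
  by apply: (inR_tr handV) wv; rewrite /inR xw.
- by move=> ->; rewrite orbT.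
- by move/mark_chain => h; rewrite h in ngt.
- by move=> ->; rewrite !orbT.
- by case/andP => h; rewrite h in ngt.
Qed.

Lemma special_touched l x : special n anc lt V l x -> A l x.
Proof. by rewrite /A /touched => ->. Qed.
Lemma edge_touched l x : edge n anc lt V l x -> A l x.
Proof. by rewrite /A /touched => ->; rewrite orbT. Qed.
Lemma mark_touched l x : mark n anc lt V M l x -> A l x.
Proof. by rewrite /A /touched => ->; rewrite !orbT. Qed.
Lemma rebuilt_touched l x : rebuilt n anc lt V M l x -> A l x.
Proof. by rewrite /A /touched => ->; rewrite !orbT. Qed.

(** Special nodes, and in each orientation edges and marks, number at most 2 per visited key, which
    gives 10. The rebuildings of each orientation add 1 per visited key and [n] in total. *)
Lemma sum_touched : \sum_(0 <= l < M) count (A l) ks <=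
  12 * \sum_(0 <= l < M) count (V l) ks + 2 * n.
Proof.
have hand' := hand_mirror handV.
apply: (@leq_trans (\sum_(0 <= l < M) (10 * count (V l) ks +
    (count (rebuilt n anc lt V M l) ks + count (rebuilt n anc gt V M l) ks)))); last first.
  have e : \sum_(0 <= l < M) 10 * count (V l) ks = 10 * \sum_(0 <= l < M) count (V l) ks.
    by rewrite big_distrr.
  rewrite big_split /= e addnC big_split /=.
  move: (sum_rebuilt M handV) (sum_rebuilt M hand'); rewrite -/ks -/gt; nlia.
apply: leq_sum => l _.
have U (P Q : pred nat) : count (predU P Q) ks <= count P ks + count Q ks.
  by rewrite -count_predUI leq_addr.
have c1 := count_special handV l; have c2 := count_edge handV l.
have c3 := count_edge hand' l; have c4 := count_mark M handV l.
have c5 := count_mark M hand' l.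
have E : A l =1 predU (special n anc lt V l) (predU (edge n anc lt V l) (predU (edge n anc gt V l)
    (predU (mark n anc lt V M l) (predU (mark n anc gt V M l)
    (predU (rebuilt n anc lt V M l) (rebuilt n anc gt V M l)))))) by [].
rewrite (eq_count E).
apply: (@leq_trans (2 * count (V l) ks + (2 * count (V l) ks + (2 * count (V l) ks +
  (2 * count (V l) ks + (2 * count (V l) ks +
  (count (rebuilt n anc lt V M l) ks + count (rebuilt n anc gt V M l) ks))))))); last by nlia.
do 5![apply: leq_trans (U _ _) (leq_add _ _) => //].
Qed.
End TouchedSatisfied.

Lemma touched_empty n anc lt V M i j x y : hand n anc lt V -> i < j ->
  touched n anc lt V M i x -> touched n anc lt V M j y -> lt x y ->
  ~ (forall z s, touched n anc lt V M s z -> i <= s <= j -> ~~ lt z x -> ~~ lt y z ->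
       (z = x /\ s = i) \/ (z = y /\ s = j)).
Proof.
move=> handV ij Ax Ay xy empty; have hand' := hand_mirror handV.
have keys l u : touched n anc lt V M l u -> u \in iota 1 n.
  by case/(touched_V handV) => v _ /(hand_keys handV)/andP[].
have [w [wx yw awx awy]] := hand_lca handV (keys _ _ Ax) (keys _ _ Ay) xy.
have [e|nwx] := eqVneq w x.
  (* The ancestor is the earlier and lesser key: this is [satisfied_down] for the reversed order. *)
  subst w; apply: (@satisfied_down _ _ _ _ M hand' (touched n anc lt V M)) Ax Ay _ _ => //.
  - by move=> l u; rewrite special_mirror; apply: special_touched.
  - by move=> l u /(edge_touched M); rewrite touched_mirror.
  - by move=> l u /mark_touched; rewrite touched_mirror.
  - by move=> l u /rebuilt_touched; rewrite touched_mirror.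
  - by move=> l u; rewrite -touched_mirror; apply: touched_chain.
  - exact: touched_V.
  - by rewrite /inL awy.
  - by move=> z s As hs h1 h2; apply: empty.
have [e|nwy] := eqVneq w y.
  subst w; apply: (@satisfied_up _ _ _ _ M handV (touched n anc lt V M)) Ax Ay _ empty => //.
  - exact: special_touched.
  - exact: edge_touched.
  - exact: mark_touched.
  - exact: rebuilt_touched.
  - exact: touched_chain.
  - exact: touched_V.
  - by rewrite /inL awx.
have lwx : lt x w by case/orP: (hand_tot handV nwx) => // h; rewrite h in wx.
have lwy : lt w y by case/orP: (hand_tot handV nwy) => // h; rewrite h in yw.
have [l hl Al] : exists2 l, i <= l <= j & touched n anc lt V M l w.
  apply: (@satisfied_lca _ _ _ _ handV (touched n anc lt V M)) Ax Ay _ _ => //.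
  - exact: special_touched.
  - exact: touched_V.
  - exact: ltnW.
  - by rewrite /inL awx.
  - by rewrite /inR awy.
by case: (empty _ _ Al hl wx yw) => -[e _]; rewrite e eqxx in nwx nwy.
Qed.

(** * Static trees *)

Lemma mem_keys t : keys t =i inorder t.
Proof.
elim: t => //= l IHl k r IHr x.
by rewrite inE !mem_cat inE IHl IHr orbCA.
Qed.

Lemma sorted_node l k r : sorted ltn (inorder (Node l k r)) ->
  [/\ sorted ltn (inorder l), sorted ltn (inorder r),
      forall x, x \in inorder l -> x < k & forall x, x \in inorder r -> k < x].
Proof.
rewrite !(sorted_pairwise ltn_trans) /= pairwise_cat /=.
case/and4P => /allrelP lk sl kr sr; split=> // x xin.
  by apply: lk => //; apply: mem_head.
exact: (allP kr).
Qed.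

Lemma rpath_notin x t : x \notin inorder t -> rpath x t = [::].
Proof.
case: t => //= l k r; rewrite mem_cat inE !mem_keys eq_sym.
by case: (k == x); case: (x \in inorder l); case: (x \in inorder r).
Qed.

Definition anc t z v := z \in rpath v t.

Lemma anc_in t z v : anc t z v -> (z \in inorder t) && (v \in inorder t).
Proof.
rewrite /anc => zv; have vt : v \in inorder t.
  by apply: contraLR zv => /rpath_notin->.
rewrite vt andbT; elim: t zv {vt} => //= l IHl k r IHr.
rewrite !mem_keys mem_cat inE; case: ifP => _; first by rewrite inE => /eqP->; rewrite eqxx orbT.
case: ifP => _; first by rewrite inE => /orP[->|/IHl->]; rewrite ?orbT.
case: ifP => _ //; by rewrite inE => /orP[->|/IHr->]; rewrite ?orbT.
Qed.

Section StaticTree.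
Variable T : tree.
Hypothesis sT : sorted ltn (inorder T).

Lemma rpath_prefix t v p z s : sorted ltn (inorder t) ->
  rpath v t = p ++ z :: s -> rpath z t = rcons p z.
Proof.
elim: t p => [|l IHl k r IHr] p st; first by case: p.
have [sl sr lk rk] := sorted_node st.
rewrite /= !mem_keys; case: (eqVneq k v) => [_|kv].
  by case: p => [|? []//] [<-]; rewrite eqxx.
case: ifP => [vl|_].
  case: p => [[<-]|a p [ea e]]; first by rewrite eqxx.
  have zl : z \in inorder l.
    have : anc l z v by rewrite /anc e mem_cat mem_head orbT.
    by case/anc_in/andP.
  have -> : (k == z) = false by have := lk _ zl; nlia.
  by rewrite zl (IHl _ sl e) ea.
case: ifP => [vr|_]; last by case: p.
case: p => [[<-]|a p [ea e]]; first by rewrite eqxx.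
have zr : z \in inorder r.
  have : anc r z v by rewrite /anc e mem_cat mem_head orbT.
  by case/anc_in/andP.
have kz := rk _ zr.
have -> : (k == z) = false by nlia.
have -> : (z \in inorder l) = false by apply/negP => /lk; nlia.
by rewrite zr (IHr _ sr e) ea.
Qed.

Lemma rpath_cons v : v \in inorder T -> exists p, rpath v T = rcons p v.
Proof.
move=> vT; suff [p [s e]] : exists p s, rpath v T = p ++ v :: s.
  by exists p; apply: rpath_prefix e.
elim: T vT => //= l IHl k r IHr; rewrite !mem_keys mem_cat inE.
case: (eqVneq k v) => [e|kv]; first by exists [::], [::]; rewrite e.
case: (boolP (v \in inorder l)) => [/IHl[p [s ->]]|_]; first by exists (k :: p), s.
move=> /= vr; rewrite vr.
by have [p [s ->]] := IHr vr; exists (k :: p), s.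
Qed.

Lemma anc_refl z : z \in inorder T -> anc T z z.
Proof. by case/rpath_cons => p e; rewrite /anc e mem_rcons mem_head. Qed.

Lemma anc_split a b : anc T a b -> exists p s, rpath b T = p ++ a :: s /\ rpath a T = rcons p a.
Proof.
rewrite /anc => ab; have [p [s e]] : exists p s, rpath b T = p ++ a :: s.
  by case/splitPr: ab => p s; exists p, s.
by exists p, s; split=> //; apply: rpath_prefix e.
Qed.

Lemma anc_trans b a c : anc T a b -> anc T b c -> anc T a c.
Proof.
move=> ab /anc_split[p [s [e eb]]]; move: ab; rewrite /anc e eb mem_rcons inE mem_cat inE.
by case/orP => ->; rewrite ?orbT.
Qed.

Lemma anc_antisym a b : anc T a b -> anc T b a -> a = b.
Proof.
move=> ab ba; have [p [s [e ea]]] := anc_split ab.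
have [p' [s' [e' eb]]] := anc_split ba.
have := congr1 size e; have := congr1 size e'; rewrite eb ea !size_cat !size_rcons /= => z1 z2.
have s0 : s = [::] by case: (s) z2 => //= *; nlia.
by move: e; rewrite s0 cats1 eb => /rcons_inj[].
Qed.

Lemma rpath_root l k r x : x \in inorder (Node l k r) ->
  exists s, rpath x (Node l k r) = k :: s.
Proof.
rewrite /= !mem_keys mem_cat inE eq_sym.
case: (k == x); first by exists [::].
case: (x \in inorder l) => [_|]; first by exists (rpath x l).
by case: (x \in inorder r) => // _; exists (rpath x r).
Qed.

Lemma anc_root l k r x : x \in inorder (Node l k r) -> anc (Node l k r) k x.
Proof. by case/rpath_root => s; rewrite /anc => ->; apply: mem_head. Qed.

Lemma lcp_pos t a b : a \in inorder t -> b \in inorder t -> 0 < lcp (rpath a t) (rpath b t).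
Proof.
case: t => // l k r /rpath_root[s1 ->] /rpath_root[s2 ->] /=.
by rewrite eqxx.
Qed.

Lemma anc_left l k r z v : sorted ltn (inorder (Node l k r)) -> v < k ->
  anc (Node l k r) z v = (z == k) && (v \in inorder l) || anc l z v.
Proof.
move=> /sorted_node[_ _ lk rk] vk; rewrite /anc /= !mem_keys.
have -> : (k == v) = false by nlia.
case: (boolP (v \in inorder l)) => [vl|nvl]; first by rewrite inE andbT.
by rewrite (rpath_notin nvl) andbF; case: ifP => // /rk; nlia.
Qed.

Lemma anc_right l k r z v : sorted ltn (inorder (Node l k r)) -> k < v ->
  anc (Node l k r) z v = (z == k) && (v \in inorder r) || anc r z v.
Proof.
move=> /sorted_node[_ _ lk rk] vk; rewrite /anc /= !mem_keys.
have -> : (k == v) = false by nlia.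
have -> : (v \in inorder l) = false by apply/negP => /lk; nlia.
case: (boolP (v \in inorder r)) => [vl|nvl]; first by rewrite inE andbT.
by rewrite (rpath_notin nvl) andbF.
Qed.

Lemma anc_at l k r z : anc (Node l k r) z k = (z == k).
Proof. by rewrite /anc /= eqxx inE. Qed.

Lemma anc_convex z v c : anc T z v -> c \in inorder T -> minn z v <= c <= maxn z v -> anc T z c.
Proof.
move=> zv cT hc; elim: T sT zv cT => // l IHl k r IHr st zv cT.
have [sl sr lk rk] := sorted_node st.
have [->|zk] := eqVneq z k; first exact: anc_root.
case: (ltngtP v k) zv => vk; last by rewrite vk anc_at (negPf zk).
  rewrite (anc_left _ st vk) (negPf zk) /= => zl.
  have /andP[/lk zk' _] := anc_in zl.
  have ck : c < k by nlia.
  rewrite (anc_left _ st ck) (IHl sl zl) ?orbT //.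
  by move: cT; rewrite /= mem_cat inE => /or3P[//|/eqP|/rk]; nlia.
rewrite (anc_right _ st vk) (negPf zk) /= => zl.
have /andP[/rk zk' _] := anc_in zl.
have ck : k < c by nlia.
rewrite (anc_right _ st ck) (IHr sr zl) ?orbT //.
by move: cT; rewrite /= mem_cat inE => /or3P[/lk|/eqP|//]; nlia.
Qed.

Lemma anc_lca x y : x \in inorder T -> y \in inorder T ->
  exists w, [/\ minn x y <= w <= maxn x y, anc T w x & anc T w y].
Proof.
elim: T sT => // l IHl k r IHr st xT yT.
have [sl sr lk rk] := sorted_node st.
have [hk|nk] := boolP (minn x y <= k <= maxn x y).
  by exists k; rewrite !anc_root.
case: (ltngtP x k) nk => xk nk; last by nlia.
  have yk : y < k by nlia.
  have inl u : u < k -> u \in inorder (Node l k r) -> u \in inorder l.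
    by move=> uk; rewrite /= mem_cat inE => /or3P[//|/eqP|/rk]; nlia.
  have [w [hw wx wy]] := IHl sl (inl _ xk xT) (inl _ yk yT).
  by exists w; rewrite !(anc_left _ st) // wx wy !orbT.
have yk : k < y by nlia.
have inr u : k < u -> u \in inorder (Node l k r) -> u \in inorder r.
  by move=> uk; rewrite /= mem_cat inE => /or3P[/lk|/eqP|//]; nlia.
have [w [hw wx wy]] := IHr sr (inr _ xk xT) (inr _ yk yT).
by exists w; rewrite !(anc_right _ st) // wx wy !orbT.
Qed.

Definition adjacent u v :=
  [&& u \in inorder T, v \in inorder T &
   (rpath v T == rcons (rpath u T) v) || (rpath u T == rcons (rpath v T) u)].

Lemma adjacent_sym u v : adjacent u v = adjacent v u.
Proof. by rewrite /adjacent orbC andbCA. Qed.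

Lemma adjacent_anc u v : adjacent u v -> anc T u v \/ anc T v u.
Proof.
case/and3P=> /anc_refl uu /anc_refl vv /orP[] /eqP e; rewrite /anc.
  by left; rewrite e mem_rcons inE -/(anc T u u) uu orbT.
by right; rewrite e mem_rcons inE -/(anc T v v) vv orbT.
Qed.

(** Removing [z] separates its left subtree, its right subtree and the rest of the tree from each
    other, and an edge that avoids [z] stays within one of the three. *)
Lemma adjacent_side z u v : adjacent u v -> z != u -> z != v ->
  anc T z u = anc T z v /\ (anc T z u -> (u < z) = (v < z)).
Proof.
move=> uv zu zv; have e : anc T z u = anc T z v.
  case/and3P: uv => _ _ /orP[] /eqP e; rewrite /anc e mem_rcons inE.
    by rewrite (negPf zv).
  by rewrite (negPf zu).
split=> // azu; have azv := azu; rewrite e in azv.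
have /andP[zT _] := anc_in azu.
apply/idP/idP => h; rewrite ltnNge; apply/negP => h'.
  case: (adjacent_anc uv) => [auv|avu].
    by have := anc_antisym azu (anc_convex auv zT _); nlia.
  by have := anc_antisym azv (anc_convex avu zT _); nlia.
case: (adjacent_anc uv) => [auv|avu].
  by have := anc_antisym azu (anc_convex auv zT _); nlia.
by have := anc_antisym azv (anc_convex avu zT _); nlia.
Qed.

Lemma path_adjacent b p w s : rpath b T = p ++ w :: s -> path adjacent w s /\ last w s = b.
Proof.
elim: s p w => [|y s IH] p w e /=.
  split=> //; have bT : b \in inorder T.
    by apply: contraT => /rpath_notin e'; move: e; rewrite e'; case: (p).
  have [q e'] := rpath_cons bT.
  by move: e; rewrite e' cats1 => /rcons_inj[].
have e2 : rpath b T = rcons p w ++ y :: s by rewrite cat_rcons.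
have [pa la] := IH _ _ e2; rewrite pa la; split=> //.
have wT : anc T w b by rewrite /anc e mem_cat mem_head orbT.
have yT : anc T y b by rewrite /anc e2 mem_cat mem_head orbT.
case/andP: (anc_in wT) => {}wT _; case/andP: (anc_in yT) => {}yT _.
by rewrite /adjacent wT yT (rpath_prefix sT e) (rpath_prefix sT e2) eqxx.
Qed.

Lemma lcp_split s1 s2 : 0 < lcp s1 s2 -> exists p w t1 t2,
  [/\ s1 = p ++ w :: t1, s2 = p ++ w :: t2 & lcp s1 s2 = (size p).+1].
Proof.
elim: s1 s2 => [|a s1 IH] [|b s2] //=; case: eqP => // <- _.
have [|l0] := posnP (lcp s1 s2); first by move=> ->; exists [::], a, s1, s2.
have [p [w [t1 [t2 [-> -> e]]]]] := IH _ l0.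
by exists (a :: p), w, t1, t2; rewrite e.
Qed.

Lemma dist_sym a b : dist T a b = dist T b a.
Proof.
rewrite /dist [RHS]addnC; suff -> : lcp (rpath a T) (rpath b T) = lcp (rpath b T) (rpath a T) by [].
elim: (rpath a T) (rpath b T) => [|x s IH] [|y s'] //=.
by rewrite eq_sym IH.
Qed.

Lemma dist_walk a b : a \in inorder T -> b \in inorder T ->
  exists s, [/\ size s = dist T a b, path adjacent a s & last a s = b].
Proof.
move=> aT bT; have pos := lcp_pos aT bT.
have [p [w [ta [tb [ea eb el]]]]] := lcp_split pos.
have [pa la] := path_adjacent ea; have [pb lb] := path_adjacent eb.
(* [w] is the last common node of the two root paths: climb from [a] to [w], then descend to [b]. *)
exists (rev (belast w ta) ++ tb); split.
- by rewrite size_cat size_rev size_belast /dist el ea eb !size_cat /=; nlia.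
- rewrite cat_path -{1}la rev_path -/(adjacent).
  have -> : last a (rev (belast w ta)) = w.
    by case: (ta) la => [//|y s] /= _; rewrite rev_cons last_rcons.
  rewrite pb andbT; apply: sub_path pa => u v; by rewrite adjacent_sym.
- rewrite last_cat; have -> : last a (rev (belast w ta)) = w => //.
  by case: (ta) la => [//|y s] /= _; rewrite rev_cons last_rcons.
Qed.
End StaticTree.

(** The first argument is fuel and bounds the depth; it suffices when [size s < 2 ^ d]. *)
Fixpoint balance d (s : seq nat) : tree :=
  match d, s with
  | d'.+1, _ :: _ =>
      let h := (size s)./2 in
      Node (balance d' (take h s)) (nth 0 s h) (balance d' (drop h.+1 s))
  | _, _ => Leaf
  end.

Lemma inorder_balance d s : size s < 2 ^ d -> inorder (balance d s) = s.
Proof.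
elim: d s => [|d IH] s; first by case: s.
have [->//|s0 sz] := eqVneq s [::].
have -> : balance d.+1 s = Node (balance d (take (size s)./2 s))
    (nth 0 s (size s)./2) (balance d (drop (size s)./2.+1 s)) by case: (s) s0.
have hs : (size s)./2 < size s by case: (s) s0 => //= *; nlia.
rewrite expnS in sz; rewrite /= !IH.
- by rewrite -drop_nth // cat_take_drop.
- by rewrite size_drop; nlia.
- by rewrite size_take hs; nlia.
Qed.

Lemma size_rpath_balance d s x : size (rpath x (balance d s)) <= d.
Proof.
elim: d s => [|d IH] [|y s] //=; case: ifP => // _.
by case: ifP => _; [apply: IH | case: ifP => // _; apply: IH].
Qed.

(** * Time windows *)

Section Fingers.
Variables (n k : nat) (T : tree) (conf : nat -> seq nat).
Let ks := iota 1 n.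
Hypothesis bT : inorder T = ks.
Hypothesis k_gt0 : 0 < k.
Hypothesis size_conf : forall t, size (conf t) = k.
Hypothesis conf_keys : forall t, {subset conf t <= ks}.
Hypothesis conf_step : forall t f, f < k ->
  nth 0 (conf t) f = nth 0 (conf t.+1) f \/ adjacent T (nth 0 (conf t) f) (nth 0 (conf t.+1) f).
Hypothesis conf_new : forall t, exists y, {subset conf t.+1 <= y :: conf t}.

(* Window l is [(l-1)k, (l+1)k], so phase l, which is [lk, (l+1)k], is contained
   in both windows l and l+1. *)
Definition visited l x := has (fun t => x \in conf t) (iota (l.-1 * k) (l.+1 * k - l.-1 * k).+1).

Lemma visitedP l x :
  reflect (exists2 t, l.-1 * k <= t <= l.+1 * k & x \in conf t) (visited l x).
Proof.
have le : l.-1 * k <= l.+1 * k by rewrite leq_mul2r; nlia.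
by apply: (iffP hasP) => -[t ht xt]; exists t => //; move: ht; rewrite mem_iota; nlia.
Qed.

Lemma visited_cover i j t : i <= j -> i.-1 * k <= t <= j.+1 * k ->
  exists2 l, i <= l <= j & l.-1 * k <= t <= l.+1 * k.
Proof.
move=> ij /andP[h1 h2].
have mono a b : a <= b -> a * k <= b * k by move=> ab; rewrite leq_mul2r ab orbT.
have d1 := leq_divM t k; have d2 : t < (t %/ k).+1 * k by rewrite ltn_ceil.
have [lt_i|ge_i] := ltnP (t %/ k) i.
  by exists i; rewrite ?leqnn ?h1 //=; apply: leq_trans (ltnW d2) (mono _ _ _); nlia.
have [le_j|gt_j] := leqP (t %/ k) j.
  exists (t %/ k); rewrite ?ge_i //; apply/andP; split; last exact: ltnW.
  by apply: leq_trans d1; apply: mono; nlia.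
exists j; rewrite ?ij ?leqnn // h2 andbT.
by apply: leq_trans (mono _ _ _) d1; nlia.
Qed.

Let sT : sorted ltn (inorder T).
Proof. by rewrite bT iota_ltn_sorted. Qed.

Lemma finger_side z f a b : a <= b -> f < k -> (forall t, a <= t <= b -> z \notin conf t) ->
  let u := nth 0 (conf a) f in let v := nth 0 (conf b) f in
  [/\ anc T z u && (u < z) = anc T z v && (v < z) &
      anc T z u && (z < u) = anc T z v && (z < v)].
Proof.
move=> ab fk nz /=; elim: b ab nz => [|b IH]; first by rewrite leqn0 => /eqP->.
rewrite leq_eqVlt => /orP[/eqP->//|]; rewrite ltnS => ab nz.
have [|-> ->] := IH ab; first by move=> t ht; apply: nz; nlia.
have nu : z != nth 0 (conf b) f.
  by apply: contraNneq (nz b _) => [->|]; [rewrite mem_nth ?size_conf | nlia].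
have nv : z != nth 0 (conf b.+1) f.
  by apply: contraNneq (nz b.+1 _) => [->|]; [rewrite mem_nth ?size_conf | nlia].
case: (conf_step b fk) => [->//|adj].
have [e h] := adjacent_side sT adj nu nv.
by rewrite -e; case: (boolP (anc T z _)) h => //= _ /(_ isT); nlia.
Qed.

Lemma hand_visited : hand n (anc T) ltn visited.
Proof.
have anti := anc_antisym sT; have tr := anc_trans sT.
have conv z v c : anc T z v -> minn z v <= c <= maxn z v -> anc T z c.
  move=> zv hc; apply: (anc_convex sT zv) => //; have := anc_in zv.
  by rewrite bT !mem_iota; nlia.
split=> //=.
- exact: ltnn.
- exact: ltn_trans.
- by move=> x y; rewrite neq_ltn.
- by move=> z v /anc_in; rewrite bT.
- by move=> z; rewrite -/ks -bT; apply: anc_refl.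
- by move=> z v c a h1 h2; apply: conv a _; nlia.
- by move=> z v c a h1 h2; apply: conv a _; nlia.
- move=> x y; rewrite -/ks -bT => xT yT xy; have [w [hw wx wy]] := anc_lca sT xT yT.
  by exists w; split=> //; nlia.
- by move=> l v /visitedP[t _ /conf_keys].
- move=> i j v ij /visitedP[t ht vt].
  have fk : index v (conf t) < k by rewrite -(size_conf t) index_mem.
  have ik : i.-1 * k <= j.-1 * k by rewrite leq_mul2r; nlia.
  have it : i.-1 * k <= t by nlia.
  (* The finger that stands on [v] at time [t] is followed back to the first moment of window [i];
     every moment on the way lies in one of the windows [i] to [j]. *)
  exists (nth 0 (conf (i.-1 * k)) (index v (conf t))).
    apply/visitedP; exists (i.-1 * k); last by rewrite mem_nth ?size_conf.
    by rewrite leqnn leq_mul2r; nlia.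
  move=> z nz; have [|h1 h2] := @finger_side z _ _ _ it fk.
    move=> s hs; have [|l hl hs'] := @visited_cover i j s ij; first by nlia.
    by apply: contra (nz l hl) => zs; apply/visitedP; exists s.
  by rewrite h1 h2 nth_index.
- move=> i j v ij /visitedP[t ht vt].
  have fk : index v (conf t) < k by rewrite -(size_conf t) index_mem.
  have ik : i.+1 * k <= j.+1 * k by rewrite leq_mul2r; nlia.
  have it : t <= j.+1 * k by nlia.
  exists (nth 0 (conf (j.+1 * k)) (index v (conf t))).
    apply/visitedP; exists (j.+1 * k); last by rewrite mem_nth ?size_conf.
    by rewrite leqnn leq_mul2r; nlia.
  move=> z nz; have [|h1 h2] := @finger_side z _ _ _ it fk.
    move=> s hs; have [|l hl hs'] := @visited_cover i j s ij; first by nlia.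
    by apply: contra (nz l hl) => zs; apply/visitedP; exists s.
  by rewrite -h1 -h2 nth_index.
Qed.

Lemma window_small a d : exists2 s, size s = k + d &
  forall t, a <= t <= a + d -> {subset conf t <= s}.
Proof.
elim: d => [|d [s sz h]].
  exists (conf a); rewrite ?size_conf ?addn0 // => t ht.
  by have -> : t = a by nlia.
have [y hy] := conf_new (a + d).
exists (y :: s); first by rewrite /= sz addnS.
move=> t ht x xt; have [e|ne] := eqVneq t (a + d).+1.
  rewrite inE; subst t; have := hy _ xt; rewrite inE => /orP[->//|xt'].
  by rewrite (h (a + d)) ?orbT //; nlia.
by rewrite inE (h t) ?orbT //; nlia.
Qed.

(** A window starts with at most [k] keys, and each of its at most [2 * k] moves adds at most
    one. *)
Lemma count_visited l : count (visited l) ks <= 3 * k.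
Proof.
have [s sz h] := window_small (l.-1 * k) (l.+1 * k - l.-1 * k).
rewrite -size_filter; apply: (@leq_trans (size s)).
  apply: uniq_leq_size; first by rewrite filter_uniq ?iota_uniq.
  move=> x; rewrite mem_filter => /andP[/visitedP[t ht xt] _]; apply: (h t) => //; nlia.
by rewrite sz -mulnBl; case: l {h sz} => [|l] /=; rewrite mulnC; nia.
Qed.

Lemma sum_visited N : \sum_(0 <= l < (N %/ k).+1) count (visited l) ks <= 3 * N + n.
Proof.
(* Since [k] may exceed [N], window 0 is charged to [n]; the other [N %/ k] windows cost [3 * k]
   each. *)
rewrite big_ltn // addnC leq_add //; last by rewrite -(size_iota 1 n) count_size.
apply: (@leq_trans (\sum_(1 <= l < (N %/ k).+1) 3 * k)).
  by apply: leq_sum => l _; apply: count_visited.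
rewrite sum_nat_const_nat subn1 /= mulnCA leq_mul2l /=; exact: leq_divM.
Qed.
End Fingers.

Lemma touched_third n anc V M i j x y : hand n anc ltn V -> i < j ->
  touched n anc ltn V M i x -> touched n anc ltn V M j y -> x != y ->
  exists z s, [/\ touched n anc ltn V M s z, i <= s <= j, minn x y <= z <= maxn x y,
                  (z, s) != (x, i) & (z, s) != (y, j)].
Proof.
move=> handV ij Ax Ay xy.
pose third z s := [&& touched n anc ltn V M s z, (z, s) != (x, i) & (z, s) != (y, j)].
have [/hasP[s hs /hasP[z hz /and3P[Az n1 n2]]]|no] :=
  boolP (has (fun s => has (third^~ s) (iota (minn x y) (maxn x y - minn x y).+1)) (iota i (j - i).+1)).
  exists z, s; rewrite !mem_iota in hs hz; split=> //; nlia.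
have empty z s : touched n anc ltn V M s z -> i <= s <= j -> minn x y <= z <= maxn x y ->
    (z = x /\ s = i) \/ (z = y /\ s = j).
  move=> Az hs hz; have [[-> ->]|n1] := eqVneq (z, s) (x, i); first by left.
  have [[-> ->]|n2] := eqVneq (z, s) (y, j); first by right.
  case/negP: no; apply/hasP; exists s; first by rewrite mem_iota; nlia.
  apply/hasP; exists z; first by rewrite mem_iota; nlia.
  by rewrite /third Az n1.
exfalso; case: (ltngtP x y) xy => // h _.
  apply: (touched_empty handV ij Ax Ay h) => z s Az hs h1 h2.
  by apply: empty => //; clear -h h1 h2; lia.
have mir l u : touched n anc (fun a b => ltn b a) V M l u = touched n anc ltn V M l u.
  exact: touched_mirror.
rewrite -mir in Ax; rewrite -mir in Ay.
apply: (touched_empty (hand_mirror handV) ij Ax Ay h) => z s.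
rewrite mir => Az hs h1 h2.
by apply: empty => //; clear -h h1 h2; lia.
Qed.

Lemma sum_isSome (f : nat -> option nat) m :
  \sum_(0 <= r < m) (isSome (f r) : nat) = size (pmap f (iota 0 m)).
Proof.
rewrite size_pmap -sum1_count [RHS]big_mkcond /index_iota subn0.
by apply: eq_bigr => r _; case: (f r).
Qed.

(** * Interleaving boundary rows with the rows inside phases *)

Section Rows.
Variables (n k N d : nat) (T : tree) (conf : nat -> seq nat) (acc : nat -> option nat).
Let ks := iota 1 n.
Hypothesis bT : inorder T = ks.
Hypothesis k_gt0 : 0 < k.
Hypothesis size_conf : forall t, size (conf t) = k.
Hypothesis conf_keys : forall t, {subset conf t <= ks}.
Hypothesis conf_step : forall t f, f < k ->
  nth 0 (conf t) f = nth 0 (conf t.+1) f \/ adjacent T (nth 0 (conf t) f) (nth 0 (conf t.+1) f).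
Hypothesis conf_new : forall t, exists y, {subset conf t.+1 <= y :: conf t}.
Hypothesis acc_conf : forall t x, acc t = Some x -> x \in conf t.
Hypothesis kd : 3 * k < 2 ^ d.

Let V := visited k conf.
Let M := (N %/ k).+1.
Let handV := hand_visited bT k_gt0 size_conf conf_keys conf_step.
Let A := touched n (anc T) ltn V M.
Let K := k.+1.
Let S l := [seq x <- ks | V l x && V l.+1 x].
Let B l := balance d (S l).

(* Row l(k+1) is the boundary before phase l, row l(k+1)+j is the time lk+j. *)
Definition row r x :=
  if r %% k.+1 == 0 then touched n (anc T) ltn (visited k conf) (N %/ k).+1 (r %/ k.+1) x
  else if acc (r %/ k.+1 * k + r %% k.+1) is Some y
    then anc (balance d [seq x <- iota 1 n |
      visited k conf (r %/ k.+1) x && visited k conf (r %/ k.+1).+1 x]) x y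
  else false.
Definition row_access r :=
  if r %% k.+1 == 0 then None else acc (r %/ k.+1 * k + r %% k.+1).

Lemma row_boundary l : row (l * K) =1 A l.
Proof. by move=> x; rewrite /row modnMl eqxx mulnK. Qed.

Lemma row_inside l j : 0 < j <= k ->
  row (l * K + j) =1 fun x => if acc (l * k + j) is Some y then anc (B l) x y else false.
Proof.
move=> /andP[j0 jk] x; have e : (l * K + j) %% K = j by rewrite modnMDl modn_small.
have e' : (l * K + j) %/ K = l by rewrite divnMDl // divn_small ?addn0.
by rewrite /row -/K e e' -/(S l) -/(B l); case: eqP => // ej; rewrite ej in j0.
Qed.

Lemma row_split r : exists l j, [/\ r = l * K + j, j <= k & l = r %/ K].
Proof.
exists (r %/ K), (r %% K); rewrite -divn_eq; split=> //.
by rewrite -ltnS ltn_mod.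
Qed.

Lemma inorder_B l : inorder (B l) = S l.
Proof.
apply: inorder_balance; apply: leq_ltn_trans kd.
apply: leq_trans (count_visited bT k_gt0 size_conf conf_new l).
by rewrite size_filter; apply: sub_count => x /andP[].
Qed.

Lemma sorted_B l : sorted ltn (inorder (B l)).
Proof. by rewrite inorder_B sorted_filter ?iota_ltn_sorted //; apply: ltn_trans. Qed.

Lemma access_B l j x : 0 < j <= k -> acc (l * k + j) = Some x -> x \in inorder (B l).
Proof.
move=> jk /acc_conf xc; rewrite inorder_B mem_filter (conf_keys xc) andbT.
by apply/andP; split; apply/(visitedP _ k_gt0); exists (l * k + j) => //;
   rewrite ?mulSn; case: l {xc} => [|l] /=; rewrite ?mulSn; nlia.
Qed.

(** The overlap of the windows serves this purpose: the balanced tree of phase [l] consists of keys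
    visited in both windows [l] and [l.+1]. *)
Lemma row_inside_A l j x : 0 < j <= k -> row (l * K + j) x -> A l x /\ A l.+1 x.
Proof.
move=> jk; rewrite row_inside //; case: (acc _) => [y|] // /anc_in/andP[+ _].
rewrite inorder_B mem_filter => /andP[/andP[v1 v2] _].
by split; apply: special_touched; rewrite /special ?v1 ?v2.
Qed.

Lemma row_satisfied : satisfied (M * K) row.
Proof.
move=> r r' x y /andP[rr rM] Rx Ry xy.
have [l [j [e jk j0]]] := row_split r; have [l' [j' [e' jk' j0']]] := row_split r'.
have ll : l <= l' by rewrite j0 j0' leq_div2r // ltnW.
have xy' : y != x by rewrite eq_sym.
have pneq (u v a b : nat) : u != v -> (u, a) != (v, b).
  by apply: contra => /eqP[->].
have sneq (u v a b : nat) : a != b -> (u, a) != (v, b).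
  by apply: contra => /eqP[_ ->].
have [j_0|j_pos] := posnP j.
  have [j'_0|j'_pos] := posnP j'.
    rewrite j_0 addn0 in e; rewrite j'_0 addn0 in e'.
    move: Rx Ry; rewrite e e' !row_boundary => Ax Ay.
    have lt : l < l' by rewrite -(ltn_pmul2r (ltn0Sn k)) -/K -e -e'.
    have [z [s [Az hs hz n1 n2]]] := touched_third handV lt Ax Ay xy.
    exists z, (s * K); rewrite row_boundary; split=> //.
    - by rewrite !leq_mul2r; case/andP: hs => -> ->; rewrite !orbT.
    - by apply: contra n1 => /eqP[-> /eqP]; rewrite eqn_mul2r /= => /eqP->.
    - by apply: contra n2 => /eqP[-> /eqP]; rewrite eqn_mul2r /= => /eqP->.
  (* A rectangle that ends inside a phase and starts in a boundary row has its corner on [y] in the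
     boundary row before that phase. *)
  have hj' : 0 < j' <= k by rewrite j'_pos.
  rewrite e' in Ry; have [Ay _] := row_inside_A hj' Ry.
  exists y, (l' * K); rewrite row_boundary; split=> //.
  - by rewrite e' leq_addr andbT e j_0 addn0 leq_mul2r ll orbT.
  - by rewrite geq_minr leq_maxr.
  - exact: pneq.
  - by apply: sneq; rewrite e'; nlia.
have [ll'|ll'] := leqP l' l; last first.
  (* A rectangle that leaves the phase of its first row has a corner in the boundary row after
     it. *)
  have hj : 0 < j <= k by rewrite j_pos.
  rewrite e in Rx; have [_ Ax] := row_inside_A hj Rx.
  exists x, (l.+1 * K); rewrite row_boundary; split=> //.
  - rewrite {1}e mulSn [K + _]addnC leq_add2l (leq_trans jk (leqnSn k)) /=.
    by rewrite e' (@leq_trans (l' * K)) ?leq_addr // -mulSnr leq_mul2r ll' orbT.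
  - by rewrite geq_minl leq_maxl.
  - by apply: sneq; rewrite e mulSn /K; nlia.
  - exact: pneq.
have el : l' = l by nlia.
rewrite el {ll ll' el l' j0'} in e' *.
have hj : 0 < j <= k by rewrite j_pos.
have hj' : 0 < j' <= k by move: rr; rewrite e e' jk'; nlia.
move: Rx Ry; rewrite e e' !row_inside //.
case E : (acc (l * k + j)) => [u|] //; case E' : (acc (l * k + j')) => [v|] // xu yv.
have /andP[xB _] := anc_in xu; have /andP[yB _] := anc_in yv.
(* Within a phase, the lowest common ancestor in the balanced tree lies on both root paths. *)
have [w [hw wx wy]] := anc_lca (sorted_B l) xB yB.
have wu := anc_trans (sorted_B l) wx xu; have wv := anc_trans (sorted_B l) wy yv.
have [ew|nw] := eqVneq w x.
  exists x, (l * K + j'); rewrite row_inside // E' -{1}ew wv; split=> //.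
  - by rewrite leqnn andbT -e -e' ltnW.
  - by rewrite geq_minl leq_maxl.
  - by apply: sneq; rewrite -e -e'; nlia.
  - exact: pneq.
exists w, (l * K + j); rewrite row_inside // E wu; split=> //.
- by rewrite leqnn /= -e -e' ltnW.
- exact: pneq.
- by apply: sneq; rewrite -e -e'; nlia.
Qed.
Lemma row_access_inside l j : 0 < j <= k -> row_access (l * K + j) = acc (l * k + j).
Proof.
move=> /andP[j0 jk]; have e : (l * K + j) %% K = j by rewrite modnMDl modn_small.
have e' : (l * K + j) %/ K = l by rewrite divnMDl // divn_small ?addn0.
by rewrite /row_access -/K e e' gtn_eqF.
Qed.

(** Boundary rows carry no access. A positive time [l * k] is the last row of the phase before
    boundary [l], so the times served start at 1. *)
Lemma pmap_row_access P : pmap row_access (iota 0 (P * K)) = pmap acc (iota 1 (P * k)).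
Proof.
have block l c j : 0 < j -> j + c <= K ->
    pmap row_access (iota (l * K + j) c) = pmap acc (iota (l * k + j) c).
  elim: c j => //= c IH j j0 jc; rewrite row_access_inside; last first.
    by rewrite j0; move: jc; rewrite /K; nlia.
  by rewrite -!addnS IH //; move: jc; rewrite /K; nlia.
elim: P => [//|P IH].
rewrite !mulSn [K + _]addnC [k + _]addnC !iotaD !pmap_cat IH add0n add1n -[(P * k).+1]addn1.
rewrite /K [iota _ k.+1]/= /=.
have -> : row_access (P * k.+1) = None by rewrite /row_access modnMl eqxx.
by rewrite /= -/K -[(P * K).+1]addn1 block // add1n.
Qed.

Lemma count_row r : count (row r) ks <=
  (if r %% K == 0 then count (A (r %/ K)) ks else 0) + d * isSome (row_access r).
Proof.
rewrite /row /row_access -/K; case: eqP => _; first exact: leq_addr.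
case: (acc _) => [y|]; last by rewrite (eq_count (a2 := pred0)) // count_pred0.
rewrite muln1 -/(S _) -/(B _); apply: leq_trans (size_rpath_balance d (S (r %/ K)) y).
rewrite -size_filter; apply: uniq_leq_size; first by rewrite filter_uniq ?iota_uniq.
by move=> x; rewrite mem_filter => /andP[].
Qed.

Lemma sum_boundary (F : nat -> nat) P :
  \sum_(0 <= r < P * K) (if r %% K == 0 then F (r %/ K) else 0) = \sum_(0 <= l < P) F l.
Proof.
elim: P => [|P IH]; first by rewrite !big_geq.
rewrite mulSn addnC (@big_cat_nat _ _ _ (P * K)) ?leq_addr //= IH big_nat_recr //=; congr (_ + _).
rewrite big_ltn; last by rewrite /K; nlia.
rewrite modnMl eqxx mulnK // big_nat big1 ?addn0 // => r /andP[h1 h2].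
have -> : r %% K = r - P * K.
  by rewrite -{1}(subnKC (ltnW h1)) modnMDl modn_small //; nlia.
by rewrite subn_eq0 leqNgt h1.
Qed.

Theorem finger_OPT X : X = pmap acc (iota 1 (M * k)) ->
  OPT n X <= size X + 17 * (36 * N + 14 * n + d * size X).
Proof.
move=> ->; rewrite -pmap_row_access.
apply: leq_trans (satisfied_OPT row_satisfied _ _) _.
- move=> r x; rewrite /row; case: eqP => _; last first.
    case: (acc _) => [y|] // /anc_in/andP[]; rewrite -/(S _) -/(B _) inorder_B.
    by rewrite mem_filter => /andP[].
  by move/(touched_V handV) => [v _ /(hand_keys handV)/andP[]].
- move=> r x; rewrite /row_access /row; case: ifP => // r0 E _.
  rewrite E; apply: (anc_refl (sorted_B (r %/ K))).
  by apply: access_B E; rewrite lt0n r0 -ltnS ltn_mod.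
rewrite leq_add2l leq_mul2l /=.
apply: (@leq_trans (\sum_(0 <= r < M * K)
    ((if r %% K == 0 then count (A (r %/ K)) ks else 0) + d * isSome (row_access r)))).
  by apply: leq_sum => r _; apply: count_row.
rewrite big_split /= (sum_boundary (fun l => count (A l) ks)); apply: leq_add; last first.
  by rewrite -big_distrr sum_isSome.
(* 12 * (3 * N + n) + 2 * n = 36 * N + 14 * n. *)
apply: leq_trans (sum_touched M handV) _.
apply: leq_trans (leq_add (leq_mul (leqnn 12) (sum_visited bT k_gt0 size_conf conf_new N)) (leqnn _)) _.
by rewrite mulnDr mulnA -addnA -mulnDl.
Qed.
End Rows.

(** * Unit moves of the fingers *)

Lemma min_ofP (P : nat -> Prop) : (exists c, P c) -> P (min_of P).
Proof.
move=> ex; rewrite /min_of; case: ClassicalEpsilon.excluded_middle_informative => // H.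
case: ex_minnP => m + _; rewrite /Pb.
by case: ClassicalEpsilon.excluded_middle_informative.
Qed.

Lemma set_nth_id (s : seq nat) i : i < size s -> set_nth 0 s i (nth 0 s i) = s.
Proof. by elim: s i => [|x s IH] [|i] //= h; rewrite IH. Qed.

Lemma subset_set_nth (s : seq nat) i y : i < size s -> {subset set_nth 0 s i y <= y :: s}.
Proof.
elim: s i => [|x s IH] [|i] //= h z; rewrite !inE.
  by case/orP => ->; rewrite ?orbT.
case/orP => [->|/(IH _ h)]; rewrite ?orbT // inE.
by case/orP => ->; rewrite ?orbT.
Qed.

Lemma size_set_nth_in (s : seq nat) i y : i < size s -> size (set_nth 0 s i y) = size s.
Proof. by move=> h; rewrite size_set_nth; apply/maxn_idPr. Qed.

Lemma pmap_id_map (A B : Type) (f : A -> option B) s : pmap id (map f s) = pmap f s.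
Proof. by elim: s => //= x s ->. Qed.

Section Walk.
Variables (n : nat) (T : tree).
Hypothesis bT : inorder T = iota 1 n.
Let sT : sorted ltn (inorder T).
Proof. by rewrite bT iota_ltn_sorted. Qed.

(** A finger may also stay where it is: such a move serves the access and accounts for the additive
    1 in its cost. *)
Definition move (c c' : seq nat) (o : option nat) : Prop :=
  (exists i y, [/\ i < size c, c' = set_nth 0 c i y, y \in iota 1 n &
     nth 0 c i = y \/ adjacent T (nth 0 c i) y]) /\
  (forall x, o = Some x -> x \in c').

Fixpoint walk (c : seq nat) (W : seq (seq nat * option nat)) : Prop :=
  if W is (c', o) :: W' then move c c' o /\ walk c' W' else True.

Lemma walk_path c i s W : i < size c -> path (adjacent T) (nth 0 c i) s ->
  walk (set_nth 0 c i (last (nth 0 c i) s)) W ->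
  exists W', [/\ walk c W', size W' = size s + size W & pmap snd W' = pmap snd W].
Proof.
elim: s c => [|y s IH] c ic /=; first by rewrite set_nth_id // => _ wW; exists W.
move=> /andP[ay ps] wW; pose c1 := set_nth 0 c i y.
have c1i : nth 0 c1 i = y by rewrite nth_set_nth /= eqxx.
have [||| W1 [w1 s1 p1]] := IH c1; rewrite ?size_set_nth_in ?c1i //.
  by rewrite set_set_nth eqxx.
exists ((c1, None) :: W1); rewrite /= s1 p1; split=> //; split=> //; split=> //.
exists i, y; split=> //; last by right.
by case/and3P: ay => _; rewrite bT.
Qed.

Lemma fcost_walk X f c : size f = size X -> all (fun i => i < size c) f ->
  {subset c <= iota 1 n} -> {subset X <= iota 1 n} ->
  exists W, [/\ walk c W, size W = fcost T c X f & pmap snd W = X].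
Proof.
elim: X f c => [|x X IH] [|i f] c //=; first by exists [::].
move=> [sf] /andP[ic af] kc kX.
have xk : x \in iota 1 n by apply: kX; apply: mem_head.
have [|||W [wW sW pW]] := IH f (set_nth 0 c i x) sf; first by rewrite size_set_nth_in.
- by move=> z /(subset_set_nth ic); rewrite inE => /orP[/eqP->//|/kc].
- by move=> z zX; apply: kX; rewrite inE zX orbT.
have pk : nth 0 c i \in inorder T by rewrite bT; apply: kc; apply: mem_nth.
rewrite -bT in xk; have [s [ss ps ls]] := dist_walk sT pk xk.
have [|W' [w' s' p']] := @walk_path c i s ((set_nth 0 c i x, Some x) :: W) ic ps.
  rewrite ls /=; split=> //; split; last first.
    by move=> _ [<-]; rewrite -{1}[x](_ : nth 0 (set_nth 0 c i x) i = x) ?mem_nth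
      ?size_set_nth_in // nth_set_nth /= eqxx.
  exists i, x; rewrite -bT xk size_set_nth_in // set_set_nth eqxx nth_set_nth /= eqxx.
  by split=> //; left.
exists W'; rewrite s' p' /= ss dist_sym sW pW; split=> //; nlia.
Qed.

Lemma walk_nth c0 c W t : walk c W -> t < size W ->
  move (nth c0 (c :: unzip1 W) t) (nth c0 (c :: unzip1 W) t.+1) (nth None (unzip2 W) t).
Proof.
elim: W c t => [|[c' o] W IH] c t //= [m w]; case: t => [//|t] tW.
exact: IH.
Qed.

Theorem walk_OPT k c W d : 0 < k -> size c = k -> {subset c <= iota 1 n} -> walk c W ->
  3 * k < 2 ^ d ->
  OPT n (pmap snd W) <= size (pmap snd W) + 17 * (36 * size W + 14 * n + d * size (pmap snd W)).
Proof.
move=> k0 sc kc wW kd.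
(* Past the end of the walk this default keeps the fingers at their last positions. *)
pose c0 := last c (unzip1 W).
pose conf t := nth c0 (c :: unzip1 W) t.
(* Time 0 is the initial configuration, before any move, and serves no access. *)
pose acc t := nth None (None :: unzip2 W) t.
have stop t : size W <= t -> conf t.+1 = conf t.
  move=> le; rewrite /conf nth_default /= ?size_map //.
  move: le; rewrite leq_eqVlt => /orP[/eqP<-|lt].
    by rewrite -[size W](size_map fst) -[X in nth _ _ X]/((size (c :: unzip1 W)).-1) nth_last.
  by rewrite nth_default //= size_map.
have step t : t < size W -> move (conf t) (conf t.+1) (acc t.+1).
  exact: walk_nth.
have inv t : size (conf t) = k /\ {subset conf t <= iota 1 n}.
  elim: t => [|t [s1 s2]]; first by [].
  have [le|lt] := leqP (size W) t; first by rewrite stop.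
  have [[i [y [ic -> yk _]]] _] := step t lt; rewrite size_set_nth_in //; split=> //.
  by move=> z /(subset_set_nth ic); rewrite inE => /orP[/eqP->|/s2].
apply: (@finger_OPT n k (size W) d T conf acc) => //.
- by move=> t; case: (inv t).
- by move=> t; case: (inv t).
- move=> t f fk; have [le|lt] := leqP (size W) t; first by left; rewrite stop.
  have [[i [y [ic -> yk h]]] _] := step t lt; rewrite nth_set_nth /=.
  by case: eqP => [->|_] //; left.
- move=> t; have [le|lt] := leqP (size W) t.
    by exists 0 => z; rewrite stop // inE => ->; rewrite orbT.
  by have [[i [y [ic -> yk _]]] _] := step t lt; exists y; apply: subset_set_nth.
- move=> [//|t] x e; have [le|lt] := leqP (size W) t; last by case: (step t lt) => _; apply.
  by move: e; rewrite /acc /= nth_default ?size_map.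
have le : size W <= (size W %/ k).+1 * k by rewrite ltnW // ltn_ceil.
rewrite -(subnKC le) iotaD pmap_cat.
have -> : pmap acc (iota (1 + size W) ((size W %/ k).+1 * k - size W)) = [::].
  apply/eqP; rewrite -size_eq0 size_pmap -leqn0 leqNgt -has_count.
  apply/hasPn => t; rewrite mem_iota => ht; rewrite /acc nth_default //= size_map; nlia.
rewrite cats0 -[pmap acc _]pmap_id_map -[pmap snd _]pmap_id_map -(size_map snd W).
congr (pmap id _); rewrite (iotaDl 1 0) -map_comp.
exact: esym (mkseq_nth None (unzip2 W)).
Qed.
End Walk.

(** The number [N] of unit moves equals the finger cost, which is at least [size X] and hence at
    least [n]; so 851 = 1 + 17 * (36 + 14). *)
Lemma OPT_leq_Fk n k X : 0 < k -> n <= size X -> {subset X <= iota 1 n} ->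
  OPT n X <= (851 + 17 * (trunc_log 2 (3 * k)).+1) * Fk n k X.
Proof.
(* With no keys there is no initial finger position, and the minimum over strategies would be the
   default of [min_of]. *)
move=> k0 nX kX; have [n0|n0] := posnP n.
  have -> : X = [::] by case: X kX {nX} => // x X /(_ x (mem_head _ _)); rewrite n0.
  suff /eqP-> : OPT n [::] == 0 by [].
  rewrite -leqn0 /OPT /min_of; case: ClassicalEpsilon.excluded_middle_informative => // H.
  case: ex_minnP => m _; apply; rewrite /Pb.
  case: ClassicalEpsilon.excluded_middle_informative => // -[].
  by exists Leaf, [::]; rewrite n0.
have [T [bT eT]] : exists T, bst_on n T /\ FkT n k T X = Fk n k X.
  apply: (@min_ofP (fun c => exists T, bst_on n T /\ FkT n k T X = c)).
  exists (FkT n k (balance n (iota 1 n)) X), (balance n (iota 1 n)); split=> //.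
  by apply: inorder_balance; rewrite size_iota ltn_expl.
have [ell [f [[s1 [s2 [s3 s4]]] ef]]] :
    exists ell f, finger_strategy n k X ell f /\ fcost T ell X f = FkT n k T X.
  apply: (@min_ofP (fun c => exists ell f, finger_strategy n k X ell f /\ fcost T ell X f = c)).
  exists (fcost T (nseq k 1) X (nseq (size X) 0)), (nseq k 1), (nseq (size X) 0); split=> //.
  by rewrite /finger_strategy !size_nseq !all_nseq k0 n0 !orbT.
have [||| W [wW sW pW]] := @fcost_walk n T bT X f ell s3; rewrite ?s1 //.
  by move=> x /(allP s2); rewrite mem_iota add1n ltnS.
have := @walk_OPT n T bT k ell W (trunc_log 2 (3 * k)).+1 k0 s1.
rewrite pW sW ef eT => /(_ _ wW (trunc_log_ltn _ _)) le.
have XF : size X <= Fk n k X.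
  rewrite -eT -ef -sW -{1}pW size_pmap; apply: leq_trans (count_size _ _) _.
  done.
apply: leq_trans (le _ isT) _; first by move=> x /(allP s2); rewrite mem_iota add1n ltnS.
move: (trunc_log _ _).+1 => d; have := leq_mul (leqnn d) XF.
move: nX XF; move: (size X) (Fk n k X) => p F; clear; nia.
Qed.

(** * Logarithms and the final constant *)

Lemma INR_expn b d : INR (b ^ d) = pow (INR b) d.
Proof. by elim: d => //= d IH; rewrite expnS -multE mult_INR IH. Qed.

Lemma log2R_geq d k a : 2 ^ d <= maxn 2 k ^ a -> Rle (INR d) (Rmult (INR a) (log2R k)).
Proof.
move=> le; set K := maxn 2 k in le *.
have K2 : Rle (INR 2) (INR K) by apply: le_INR; apply/leP; rewrite leq_maxl.
have e2 : INR 2 = IZR 2 by [].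
have l2 : Rlt 0 (ln (INR 2)) by rewrite -ln_1 e2; apply: ln_increasing; lra.
have h : Rle (Rmult (INR d) (ln (INR 2))) (Rmult (INR a) (ln (INR K))).
  rewrite -!ln_pow; try lra.
  rewrite -!INR_expn; have pos : Rlt 0 (INR (2 ^ d)).
    by apply: lt_0_INR; apply/ltP; rewrite expn_gt0.
  case: (Rle_lt_or_eq_dec _ _ (le_INR _ _ (elimT leP le))) => [lt|->]; last by lra.
  by have := ln_increasing _ _ pos lt; lra.
rewrite /log2R -/K /Rdiv -Rmult_assoc.
apply: (Rmult_le_reg_r (ln (INR 2))) => //; rewrite Rmult_assoc Rinv_l; lra.
Qed.

Theorem theorem2 :
  exists c : R, Rlt 0 c /\
    forall (k n m : nat) (X : seq nat),
      (1 <= k)%N -> (n <= m)%N ->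
      size X = m -> all (fun x => (1 <= x <= n)%N) X ->
      Rle (INR (OPT n X)) (Rmult (Rmult c (log2R k)) (INR (Fk n k X))).
Proof.
(* 919 = 851 + 17 + 3 * 17, using [log2R k >= 1] and [trunc_log 2 (3 * k) <= 3 * log2R k]. *)
exists (IZR 919); split; first by lra.
move=> k n m X k0 nm sX /allP kX.
have le := @OPT_leq_Fk n k X k0.
have {}le : OPT n X <= (851 + 17 * (trunc_log 2 (3 * k)).+1) * Fk n k X.
  by apply: le; rewrite ?sX // => x /kX; rewrite mem_iota add1n ltnS.
have L1 : Rle 1 (log2R k).
  have := @log2R_geq 1 k 1; rewrite !expn1 leq_maxl => /(_ isT) /=; lra.
have Ld : Rle (INR (trunc_log 2 (3 * k))) (Rmult 3 (log2R k)).
  have := @log2R_geq (trunc_log 2 (3 * k)) k 3; rewrite [INR 3](_ : _ = IZR 3) //; last by rewrite /=; lra.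
  apply.
  (* With [K = maxn 2 k], [3 * k <= K ^ 3] because [3 <= K ^ 2] and [k <= K]. *)
  apply: leq_trans (trunc_logP _ _) _ => //; first by nia.
  have : k <= maxn 2 k by rewrite leq_maxr.
  have : 2 <= maxn 2 k by rewrite leq_maxl.
  by move: (maxn 2 k) => K; rewrite !expnS; nia.
move/leP/le_INR: le; rewrite mult_INR plus_INR mult_INR [INR (trunc_log _ _).+1]S_INR => le.
apply: Rle_trans le _; apply: Rmult_le_compat_r; first exact: pos_INR.
have -> : INR 851 = IZR 851 by rewrite INR_IZR_INZ.
have -> : INR 17 = IZR 17 by rewrite INR_IZR_INZ.
lra.
Qed.
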